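(* Let $\Omega=(a,b)$ with real numbers $a<b$. For all grid sizes $h$, each $q\in\mathbb{N}$ and each $p\in\mathbb{N}$ with $0<q\le p+1$ and with $h(p-q+1)<|\Omega|$, there is for each $u\in H^q(\Omega)$ a spline approximation $u_{p,h}\in\widetilde{S}^{(q)}_{p,h}(\Omega)$ such that $$|u-u_{p,h}|_{H^{q-1}(\Omega)}\le\sqrt{2}\,h\,|u|_{H^q(\Omega)},$$ where $\widetilde{S}^{(q)}_{p,h}(\Omega)$ is the space of all $u_{p,h}\in S_{p,h}(\Omega)$ that satisfy the symmetry condition $$\frac{\partial^{2l+q}}{\partial x^{2l+q}}u_{p,h}(a)=\frac{\partial^{2l+q}}{\partial x^{2l+q}}u_{p,h}(b)=0\quad\text{for all }l\in\mathbb{N}_0\text{ with }2l+q<p.$$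
   Context: $\mathbb{N}=\{1,2,3,\ldots\}$, $\mathbb{N}_0=\mathbb{N}\cup\{0\}$, $|\Omega|=b-a$. A grid size for $\Omega=(a,b)$ is a real $h>0$ such that $n_h:=h^{-1}(b-a)\in\mathbb{N}$. $H^r(\Omega)$ is the standard Sobolev space ($H^0=L^2$) and $|u|_{H^r(\Omega)}:=\|\frac{\partial^r}{\partial x^r}u\|_{L^2(\Omega)}$ (so $|u|_{H^0(\Omega)}=\|u\|_{L^2(\Omega)}$). $\mathbb{P}^p$ is the space of polynomials of degree at most $p$, and $$S_{p,h}(\Omega):=\{u\in H^p(\Omega): u|_{(a+hj,a+h(j+1)]}\in\mathbb{P}^p\text{ for all }j=0,\ldots,n_h-1\}.$$ *)

(* Defs.v *)
From mathcomp Require Import all_boot all_order all_algebra.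
From mathcomp Require Import all_classical all_reals all_analysis.
Import Order.TTheory GRing.Theory Num.Theory.
Import numFieldNormedType.Exports.

Set Implicit Arguments.
Unset Strict Implicit.
Unset Printing Implicit Defensive.

Local Open Scope classical_set_scope.
Local Open Scope ring_scope.

(* Throughout, a function on the interval (a, b) is a function on R whose values
   outside (a, b] are irrelevant; [u \_ D] is the extension by zero of the
   restriction of u to D. *)

Definition L2 (R : realType) (a b : R) (u : R -> R) : Prop :=
  u \_ `]a, b[ \in Lfun (@lebesgue_measure R) 2%:E.

Definition L2norm (R : realType) (a b : R) (u : R -> R) : \bar R :=
  ('N[@lebesgue_measure R]_2%:E[EFin \o (u \_ `]a, b[)])%E.

Definition test_function (R : realType) (a b : R) (phi : R -> R) : Prop :=
  [/\ forall (n : nat) (x : R), derivable (derive1n n phi) x 1,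
      compact (closure [set x | phi x != 0])
    & closure [set x | phi x != 0] `<=` `]a, b[].

Definition is_weak_derivative (R : realType) (a b : R) (k : nat)
    (u v : R -> R) : Prop :=
  forall phi : R -> R, test_function a b phi ->
    \int[@lebesgue_measure R]_(x in `]a, b[) (u x * derive1n k phi x) =
    (-1) ^+ k * \int[@lebesgue_measure R]_(x in `]a, b[) (v x * phi x).

Definition sobolev (R : realType) (a b : R) (r : nat) : set (R -> R) :=
  [set u | L2 a b u /\
    forall k : nat, (k <= r)%N ->
      exists v : R -> R, L2 a b v /\ is_weak_derivative a b k u v].

(* A representative of the r-th weak derivative; it is unique only up to
   a null set, and is the junk value 0 if u has no such derivative in L^2. *)
Definition weak_derivative (R : realType) (a b : R) (r : nat) (u : R -> R) :
    R -> R :=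
  xget (cst 0) [set v | L2 a b v /\ is_weak_derivative a b r u v].

Definition sobolev_seminorm (R : realType) (a b : R) (r : nat) (u : R -> R) :
    \bar R :=
  L2norm a b (weak_derivative a b r u).

Definition is_grid_size (R : realType) (a b h : R) : Prop :=
  0 < h /\ exists2 n : nat, (0 < n)%N & h^-1 * (b - a) = n%:R.

(* For a grid size h, the truncation is exact. *)
Definition grid_count (R : realType) (a b h : R) : nat :=
  Num.truncn (h^-1 * (b - a)).

(* The pieces being left-open and right-closed, together they cover (a, b]. *)
Definition spline_space (R : realType) (a b : R) (p : nat) (h : R) :
    set (R -> R) :=
  [set u | sobolev a b p u /\
    forall j : nat, (j < grid_count a b h)%N ->
      exists2 P : {poly R}, (size P <= p.+1)%N &
        forall x : R, x \in `]a + h * j%:R, a + h * j.+1%:R] ->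
          u x = P.[x]].

(* A spline is a polynomial near each end of (a, b), so its derivatives exist
   there in the classical sense; their values at a and b are the one-sided
   limits from inside (a, b). *)
Definition symmetric_spline_space (R : realType) (a b : R) (q p : nat) (h : R) :
    set (R -> R) :=
  [set u | spline_space a b p h u /\
    forall l : nat, (2 * l + q < p)%N ->
      (derive1n (2 * l + q) u x @[x --> a^'+] --> (0 : R)) /\
      (derive1n (2 * l + q) u x @[x --> b^'-] --> (0 : R))].

(* Main.v *)
Require Import Defs.
From mathcomp Require Import all_boot all_order all_algebra.
From mathcomp Require Import all_classical all_reals all_analysis.
From mathcomp Require Import measurable_realfun ring lra zify.
Import Order.TTheory GRing.Theory Num.Theory.
Import numFieldNormedType.Exports.
Set Implicit Arguments.
Unset Strict Implicit.
Unset Printing Implicit Defensive.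
Local Open Scope classical_set_scope.
Local Open Scope ring_scope.

(* Differentiating q - 1 times reduces the claim to q = 1: for v in L^2, with
   primitive w, one needs a spline s of degree r = p - q + 1 whose odd
   derivatives of order below r vanish at a and b, with |w - s| <= h |v|.
   This is proved by induction on r, together with the analogous statement for
   w vanishing at both ends and splines whose even derivatives vanish there.
   For r = 0 one takes the step function with the values of w at the knots. For
   the step from r to r + 1, let t be the L^2-projection of v on the splines of
   degree r of the opposite parity, e = v - t, and s a primitive of t, so that
   E = w - s is a primitive of e (of mean 0 if s is determined up to a constant
   only). If Z is a primitive of E and t' the approximation of Z of degree r,
   then |E|^2 = - (e, Z) = - (e, Z - t') <= |e| h |E|, whence |E| <= h |e| <= h |v|.
   To pass from weak derivatives to primitives, one needs that functions
   orthogonal to all test functions vanish almost everywhere, which is obtained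
   from smooth functions converging boundedly to indicators of intervals. *)

(** * Square-integrable functions on [a, b] and their inner product *)

Section SquareIntegrable.
Context {R : realType}.
Variables a b : R.
Notation mu := (@lebesgue_measure R).
Implicit Types (f g k : R -> R) (c M : R).

(** The closed interval suits continuity and primitives; [L2E] identifies this notion with [L2],
    which lives on the open interval. *)
Definition sq f : Prop := measurable_fun `[a, b] f /\
  mu.-integrable `[a, b] (EFin \o (fun x => f x ^+ 2)).

Definition ip f g : R := \int[mu]_(x in `[a, b]) (f x * g x).

Definition itg f : Prop := mu.-integrable `[a, b] (EFin \o f).

Lemma itg_le f g : measurable_fun `[a, b] f ->
  (forall x, x \in `[a, b] -> `|f x| <= `|g x|) -> itg g -> itg f.
Proof.
move=> mf fg; apply: le_integrable => //; exact/measurable_EFinP.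
Qed.

Lemma itg_measurable f : itg f -> measurable_fun `[a, b] f.
Proof. by move/measurable_int/measurable_EFinP. Qed.

Lemma itgD f g : itg f -> itg g -> itg (f \+ g).
Proof. by move=> fi gi; exact: (integrableD _ fi gi). Qed.

Lemma itgZ c f : itg f -> itg (fun x => c * f x).
Proof. by move=> fi; exact: (integrableZl _ c fi). Qed.

Lemma itg_bounded f M : measurable_fun `[a, b] f ->
  (forall x, x \in `[a, b] -> `|f x| <= M :> R) -> itg f.
Proof.
move=> mf fM; apply: measurable_bounded_integrable => //.
  by rewrite /= lebesgue_measure_itv/=; case: ifP => // _; rewrite -EFinB ltry.
exists M; split; first exact: num_real.
by move=> N MN x xab; apply: le_trans (fM _ xab) _; exact: ltW.
Qed.

Lemma itg_cst c : itg (cst c).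
Proof. by apply: (@itg_bounded _ `|c|). Qed.

Lemma sq_mul f g : sq f -> sq g -> itg (fun x => f x * g x).
Proof.
move=> [mf fi] [mg gi].
apply: itg_le (itgD fi gi); first exact: measurable_funM.
move=> x _ /=; rewrite (@ger0_norm _ (_ + _)) ?addr_ge0 ?sqr_ge0// ler_norml.
by apply/andP; split; nra.
Qed.

Lemma sqE f : measurable_fun `[a, b] f -> itg (fun x => f x * f x) -> sq f.
Proof. by []. Qed.

Lemma sq_bounded f M : measurable_fun `[a, b] f ->
  (forall x, x \in `[a, b] -> `|f x| <= M :> R) -> sq f.
Proof.
move=> mf fM; apply: sqE => //; apply: (@itg_bounded _ (M * M)).
  exact: measurable_funM.
by move=> x /fM h; rewrite normrM ler_pM.
Qed.

Lemma sq_cst c : sq (cst c).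
Proof. by apply: (@sq_bounded _ `|c|). Qed.

Lemma sq_itg f : sq f -> itg f.
Proof.
move=> fi; have := sq_mul fi (sq_cst 1); rewrite /itg.
by congr (mu.-integrable _ _); apply/funext => x /=; rewrite mulr1.
Qed.

Lemma sqZ c f : sq f -> sq (fun x => c * f x).
Proof.
move=> [mf fi]; apply: sqE.
  by apply: measurable_funM => //.
have := itgZ (c * c) fi; rewrite /itg.
by congr (mu.-integrable _ _); apply/funext => x /=; congr EFin; ring.
Qed.

Lemma sqD f g : sq f -> sq g -> sq (fun x => f x + g x).
Proof.
move=> fi gi; apply: sqE.
  by apply: measurable_funD => //; [case: fi|case: gi].
have := itgD (itgD fi.2 (itgZ 2 (sq_mul fi gi))) gi.2; rewrite /itg.
by congr (mu.-integrable _ _); apply/funext => x /=; congr EFin; ring.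
Qed.

Lemma sqB f g : sq f -> sq g -> sq (fun x => f x - g x).
Proof.
move=> fi gi; have := sqD fi (sqZ (-1) gi).
by under [X in sq X -> _]funext do rewrite mulN1r.
Qed.

Lemma sq_continuous f : {within `[a, b], continuous f} -> sq f.
Proof.
move=> cf; apply: sqE.
  exact: subspace_continuous_measurable_fun.
apply: continuous_compact_integrable; first exact: segment_compact.
by move=> x; apply: continuousM; exact: cf.
Qed.

Lemma eq_ip f f' g g' : {in `[a, b], f =1 f'} -> {in `[a, b], g =1 g'} ->
  ip f g = ip f' g'.
Proof.
by move=> ff gg; apply: eq_Rintegral => x; rewrite inE => xab; rewrite ff ?gg.
Qed.

Lemma ipC f g : ip f g = ip g f.
Proof. by apply: eq_Rintegral => x _; rewrite mulrC. Qed.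

Lemma ip_ge0 f : 0 <= ip f f.
Proof. by apply: Rintegral_ge0 => x _; rewrite -expr2 sqr_ge0. Qed.

Lemma ipDl f g k : sq f -> sq g -> sq k ->
  ip (fun x => f x + g x) k = ip f k + ip g k.
Proof.
move=> fi gi ki; rewrite /ip -RintegralD//; try exact: sq_mul.
by apply: eq_Rintegral => x _; rewrite mulrDl.
Qed.

Lemma ipZl c f k : sq f -> sq k -> ip (fun x => c * f x) k = c * ip f k.
Proof.
move=> fi ki; rewrite /ip -RintegralZl//; last exact: sq_mul.
by apply: eq_Rintegral => x _; rewrite mulrA.
Qed.

Lemma ipBl f g k : sq f -> sq g -> sq k ->
  ip (fun x => f x - g x) k = ip f k - ip g k.
Proof.
move=> fi gi ki; rewrite -[in RHS]mulN1r -ipZl// -ipDl//; last exact: sqZ.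
by apply: eq_ip => // x _; rewrite mulN1r.
Qed.

Lemma ipDr f g k : sq f -> sq g -> sq k ->
  ip k (fun x => f x + g x) = ip k f + ip k g.
Proof. by move=> *; rewrite !(ipC k) ipDl. Qed.

Lemma ipZr c f k : sq f -> sq k -> ip k (fun x => c * f x) = c * ip k f.
Proof. by move=> *; rewrite !(ipC k) ipZl. Qed.

Lemma ipBr f g k : sq f -> sq g -> sq k ->
  ip k (fun x => f x - g x) = ip k f - ip k g.
Proof. by move=> *; rewrite !(ipC k) ipBl. Qed.

Lemma ipB_sqr f g : sq f -> sq g ->
  ip (fun x => f x - g x) (fun x => f x - g x) =
  ip f f - 2 * ip f g + ip g g.
Proof.
move=> fi gi; have fgi := sqB fi gi.
by rewrite ipBl// !ipBr// (ipC g f); ring.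
Qed.

End SquareIntegrable.

(** * Primitives and integration by parts *)

Section Primitive.
Context {R : realType}.
Variables a b : R.
Hypothesis ab : a < b.
Notation mu := (@lebesgue_measure R).
Notation itg := (itg a b).
Notation ip := (ip a b).
Notation sq := (sq a b).
Implicit Types (f g : R -> R) (c x y : R).

(* Capping the upper end at b makes [prim] linear on all of R for functions
   that are integrable on [a, b] only. *)
Definition prim f x : R := \int[mu]_(t in `[a, Num.min x b]) f t.

Lemma itg_sub f u v : a <= u -> v <= b -> itg f ->
  mu.-integrable `[u, v] (EFin \o f).
Proof.
move=> au vb; apply: integrableS => //; exact: subset_itv.
Qed.

Lemma primE f x : x \in `[a, b] -> prim f x = \int[mu]_(t in `[a, x]) f t.
Proof. by rewrite in_itv/= /prim => /andP[_ xb]; rewrite min_l. Qed.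

Lemma prim_a f : prim f a = 0.
Proof.
by rewrite /prim min_l ?(ltW ab)// set_itv1 Rintegral_set1.
Qed.

Lemma prim_b f : prim f b = ip f (cst 1).
Proof. by rewrite /prim minxx; apply: eq_Rintegral => x _; rewrite mulr1. Qed.

Lemma primD f g x : itg f -> itg g ->
  prim (fun t => f t + g t) x = prim f x + prim g x.
Proof.
by move=> fi gi; rewrite /prim RintegralD//;
  apply: itg_sub => //; rewrite ge_min lexx orbT.
Qed.

Lemma primZ c f x : itg f -> prim (fun t => c * f t) x = c * prim f x.
Proof.
by move=> fi; rewrite /prim RintegralZl//;
  apply: itg_sub => //; rewrite ge_min lexx orbT.
Qed.

Lemma primB f g x : itg f -> itg g ->
  prim (fun t => f t - g t) x = prim f x - prim g x.
Proof.
by move=> fi gi; rewrite /prim RintegralB//;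
  apply: itg_sub => //; rewrite ge_min lexx orbT.
Qed.

Lemma prim_continuous f : itg f -> {within `[a, b], continuous (prim f)}.
Proof.
move=> fi; have := parameterized_integral_continuous (ltW ab) fi.
apply: subspace_eq_continuous => x; rewrite inE => xab.
by rewrite /parameterized_integral [RHS]primE.
Qed.

Lemma sq_prim f : itg f -> sq (prim f).
Proof. by move=> fi; apply/sq_continuous/prim_continuous. Qed.

Lemma prim_sub f x y : itg f -> a <= x -> x <= y -> y <= b ->
  prim f y - prim f x = \int[mu]_(t in `]x, y]) f t.
Proof.
move=> fi ax xy yb; have xb := le_trans xy yb.
rewrite !primE ?in_itv/= ?ax ?(le_trans ax xy)//.
rewrite Rintegral_itvB//; exact: itg_sub.
Qed.

Lemma prim_subb f x : itg f -> x \in `[a, b] ->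
  \int[mu]_(t in `[x, b]) f t = prim f b - prim f x.
Proof.
rewrite in_itv/= => fi /andP[ax xb]; rewrite prim_sub// Rintegral_itv_obnd_cbnd//.
by apply: integrableS (itg_sub ax (lexx b) fi) => //; exact: subset_itv_oc_cc.
Qed.

Let integrable_patch f u v : a <= u -> v <= b -> itg f ->
  mu.-integrable setT (EFin \o (f \_ `[u, v])).
Proof.
move=> au vb fi; rewrite -restrict_EFin.
by apply/integrable_restrict => //=; rewrite setTI; exact: itg_sub.
Qed.

(** The product f(x) g(y) cut off to the triangle a <= y <= x <= b. Its slices in the two variables
    are given by [kernelE1] and [kernelE2]. *)
Let kernel f g (z : R * R) : R :=
  (f \_ `[a, b]) z.1 * ((g \_ `[a, b]) z.2 * \1_[set w : R * R | w.2 <= w.1] z).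

Let kernelE1 f g x y :
  kernel f g (x, y) = (f \_ `[a, b]) x * (g \_ `[a, Num.min x b]) y.
Proof.
rewrite /kernel/=; congr (_ * _); rewrite !patchE indicE.
have -> : ((x, y) \in [set w : R * R | w.2 <= w.1]) = (y <= x).
  by apply/idP/idP; rewrite inE.
rewrite !mem_setE !in_itv/= le_min.
by case: (a <= y); case: (y <= x); case: (y <= b); rewrite /= ?mulr0 ?mulr1 ?mul0r.
Qed.

Let kernelE2 f g x y :
  kernel f g (x, y) = (g \_ `[a, b]) y * (f \_ `[y, b]) x.
Proof.
rewrite /kernel/= mulrCA; rewrite !patchE indicE.
have -> : ((x, y) \in [set w : R * R | w.2 <= w.1]) = (y <= x).
  by apply/idP/idP; rewrite inE.
rewrite !mem_setE !in_itv/=; case: ifPn => [/andP[ay yb]|]; last by rewrite !mul0r.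
congr (_ * _).
have [yx|] := leP y x; last by rewrite mulr0.
by rewrite (le_trans ay yx) mulr1.
Qed.

Let kernel_measurable f g : itg f -> itg g -> measurable_fun setT (kernel f g).
Proof.
move=> fi gi.
have pm k : itg k -> measurable_fun setT (k \_ `[a, b]).
  move=> ki.
  by have /measurable_int/measurable_EFinP := integrable_patch (lexx a) (lexx b) ki.
apply: measurable_funM.
  by apply: measurableT_comp; [exact: pm|exact: measurable_fst].
apply: measurable_funM.
  by apply: measurableT_comp; [exact: pm|exact: measurable_snd].
apply: measurable_indic.
rewrite -[X in measurable X]setTI.
exact: measurable_fun_le.
Qed.

Let EFin_Rint (k : R -> R) : mu.-integrable setT (EFin \o k) ->
  (\int[mu]_x (k x)%:E = (\int[mu]_x k x)%:E)%E.
Proof. by move=> ki; rewrite fineK//; exact: integrable_fin_num ki. Qed.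

(** By Tonelli: the kernel is dominated by |f(x)| |g(y)|, whose iterated integral is the product of
    the two L^1 norms. *)
Let kernel_integrable f g : itg f -> itg g ->
  (mu \x mu)%E.-integrable setT (EFin \o kernel f g).
Proof.
move=> fi gi; apply/integrable12ltyP.
  apply/measurable_EFinP. exact: (kernel_measurable fi gi).
have fI := integrable_patch (lexx a) (lexx b) fi.
have gI := integrable_patch (lexx a) (lexx b) gi.
have /integrableP[_ +] := fI; have /integrableP[_ +] := gI.
set A := (\int[mu]_y _)%E; set B := (\int[mu]_x _)%E => Aoo Boo.
apply: (@le_lt_trans _ _ (\int[mu]_x (`|(f \_ `[a, b]) x|%:E * A))%E).
  apply: ge0_le_integral => //.
  - by move=> x _; exact: integral_ge0.
  - have := @measurable_fun_fubini_tonelli_F _ _ (measurableTypeR R)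
      (measurableTypeR R) R mu (abse \o (EFin \o kernel f g)).
    apply => //=.
    apply: measurableT_comp => //; apply/measurable_EFinP.
    exact: (kernel_measurable fi gi).
  - apply: emeasurable_funM => //; apply: measurableT_comp => //.
    by apply: measurableT_comp => //; have /measurable_int/measurable_EFinP := fI.
  move=> x _; rewrite -ge0_integralZl//; last first.
    by apply: measurableT_comp => //; exact: measurable_int gI.
  apply: ge0_le_integral => //.
  - apply: measurableT_comp => //; apply/measurable_EFinP.
    exact: (measurableT_comp (kernel_measurable fi gi) (measurable_pair1 x)).
  - apply: emeasurable_funM => //.
    by apply: measurableT_comp => //; exact: measurable_int gI.
  move=> y _; rewrite /kernel/= normrM -EFinM lee_fin ler_wpM2l//.
  rewrite normrM ler_piMr// indicE ger0_norm//.
  by case: (_ \in _).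
rewrite ge0_integralZr//.
- rewrite lte_mul_pinfty//; first exact: integral_ge0.
  by rewrite ge0_fin_numE//; exact: integral_ge0.
- apply/measurable_EFinP; apply: measurableT_comp => //.
  by have /measurable_int/measurable_EFinP := fI.
- exact: integral_ge0.
Qed.

(** Integration by parts without pointwise derivatives, by Fubini on the triangle: one order of
    integration gives the integral of [f * prim g], the other that of [g * (prim f b - prim f)]. *)
Lemma ip_prim f g : sq f -> sq g ->
  ip f (prim g) = prim f b * prim g b - ip g (prim f).
Proof.
move=> fs gs; have [fi gi] := (sq_itg fs, sq_itg gs).
have fI := integrable_patch (lexx a) (lexx b) fi.
have gI := integrable_patch (lexx a) (lexx b) gi.
have := Fubini (kernel_integrable fi gi) => /=.
have -> : (fun x => \int[mu]_y (kernel f g (x, y))%:E)%E =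
    EFin \o ((fun x => f x * prim g x) \_ `[a, b]).
  apply/funext => x /=; under eq_integral do rewrite kernelE1 EFinM.
  have gx : mu.-integrable setT (EFin \o (g \_ `[a, Num.min x b])).
    by apply: integrable_patch => //; rewrite ge_min lexx orbT.
  rewrite integralZl//= EFin_Rint// -EFinM -Rintegral_mkcond !patchE.
  by case: ifP; rewrite ?mul0r.
have -> : (fun y => \int[mu]_x (kernel f g (x, y))%:E)%E =
    EFin \o ((fun y => g y * (prim f b - prim f y)) \_ `[a, b]).
  apply/funext => y /=; under eq_integral do rewrite kernelE2 EFinM.
  rewrite !patchE; case: ifPn => [/set_mem yab|]; last first.
    by move=> _; under eq_integral do rewrite mul0e; rewrite integral0.
  have ay : a <= y by move: yab; rewrite /= in_itv => /andP[].
  rewrite integralZl//=; last exact: integrable_patch.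
  rewrite EFin_Rint; last exact: integrable_patch.
  by rewrite -EFinM -Rintegral_mkcond prim_subb.
move=> /(congr1 fine); rewrite -!/(Rintegral _ _ _) -!Rintegral_mkcond => h.
rewrite [LHS]h.
have pfs := sq_prim fi; have cs := sq_cst a b (prim f b).
rewrite [LHS](_ : _ = ip g (fun x => prim f b - prim f x))// ipBr//.
congr (_ - _); rewrite [prim g b]prim_b -ipZr//; last exact: sq_cst.
by apply: eq_ip => // x _; rewrite mulr1.
Qed.

End Primitive.

(** * Finite-dimensional spaces of functions and orthogonal projection *)

Section FiniteDimension.
Context {R : realType}.
Variables a b : R.
Hypothesis ab : a < b.
Notation ip := (ip a b).
Notation sq := (sq a b).
Implicit Types (f g k s t u v : R -> R) (c x y : R) (V : set (R -> R)).

Definition adjoin f V : set (R -> R) :=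
  [set g | exists c k, V k /\ g = (fun x => c * f x + k x)].

(** Finite dimension is given by a list of generators, with no independence asked, so that every
    closure property is an induction adding one generator at a time. *)
Inductive fdim : set (R -> R) -> Prop :=
| fdim0 : fdim [set cst 0]
| fdimS f V : sq f -> fdim V -> fdim (adjoin f V).

Lemma fdim_sq V f : fdim V -> V f -> sq f.
Proof.
move=> fV; elim: fV f => [_ ->|f {}V sf _ ih _ [c [k [Vk ->]]]].
  exact: sq_cst.
by apply: sqD; [exact: sqZ|exact: ih].
Qed.

Lemma fdim_lin V c f g : fdim V -> V f -> V g -> V (fun x => c * f x + g x).
Proof.
move=> fV; elim: fV f g => [f g -> ->|f0 {}V sf _ ih f g].
  by apply/funext => x /=; rewrite mulr0 addr0.
move=> [c1 [k1 [V1 ->]]] [c2 [k2 [V2 ->]]].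
exists (c * c1 + c2), (fun x => c * k1 x + k2 x); split; first exact: ih.
by apply/funext => x; ring.
Qed.

Lemma fdim_cst0 V : fdim V -> V (cst 0).
Proof.
elim=> [//|f {}V _ _ V0]; exists 0, (cst 0); split => //.
by apply/funext => x /=; ring.
Qed.

Lemma fdim_scale V c f : fdim V -> V f -> V (fun x => c * f x).
Proof.
move=> fV Vf; have := fdim_lin c fV Vf (fdim_cst0 fV).
by under [X in V X -> _]funext do rewrite /= addr0.
Qed.

Lemma ip0r f : ip f (cst 0) = 0.
Proof.
rewrite /ip (@eq_Rintegral _ _ _ _ _ (cst 0)) ?Rintegral_cst ?mul0r//.
by move=> x _ /=; rewrite mulr0.
Qed.

(** Gram-Schmidt on the generators; completeness of L^2 does not enter. *)
Lemma fdim_projection V u : fdim V -> sq u ->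
  exists2 t, V t & forall g, V g -> ip (fun x => u x - t x) g = 0.
Proof.
move=> fV; elim: fV u => [u su|f {}V sf fV ih u su].
  by exists (cst 0) => // _ ->; exact: ip0r.
have [t Vt ut] := ih u su; have [f' Vf' ff'] := ih f sf.
have [st sf'] := (fdim_sq fV Vt, fdim_sq fV Vf').
pose d x := f x - f' x; pose e x := u x - t x.
have [sd se] : sq d /\ sq e by split; exact: sqB.
have dV g : V g -> ip d g = 0 by exact: ff'.
(* Subtracting from e = u - t its projection on d = f - f' (if d is not null)
   keeps it orthogonal to V and makes it orthogonal to f = f' + d. *)
have [l el] : exists l, ip (fun x => e x - l * d x) d = 0.
  have [d0|d0] := eqVneq (ip d d) 0; last first.
    exists (ip e d / ip d d).
    by rewrite ipBl ?ipZl//; [rewrite divfK// subrr|exact: sqZ].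
  (* If [d] is null, the squared norm of [e - l d] is affine in [l] and nonnegative, so its slope
     vanishes: otherwise the value of [l] chosen below would make it negative. *)
  exists 0; rewrite ipBl ?ipZl ?mul0r ?subr0//; last exact: sqZ.
  have hl (l : R) : 0 <= ip e e - 2 * l * ip e d.
    have := @ip_ge0 _ a b (fun x => e x - l * d x).
    rewrite ipB_sqr//; last exact: sqZ.
    rewrite ipZr// ipZr//; last exact: sqZ.
    by rewrite ipZl// d0; lra.
  have := hl ((ip e e + 1) / (ip e d)).
  have [->//|ed0] := eqVneq (ip e d) 0.
  by rewrite -mulrA divfK//; have := @ip_ge0 _ a b e; nra.
have sr : sq (fun x => e x - l * d x) by apply: sqB => //; exact: sqZ.
exists (fun x => l * f x + (- l * f' x + t x)).
  by exists l, (fun x => - l * f' x + t x); split => //; exact: fdim_lin.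
move=> _ [c [k [Vk ->]]].
rewrite (@eq_ip _ _ _ _ (fun x => e x - l * d x) _
  (fun x => c * d x + (c * f' x + k x))); last 2 first.
- by move=> x _; rewrite /e /d; ring.
- by move=> x _; rewrite /e /d; ring.
have Vc : V (fun x => c * f' x + k x) by exact: fdim_lin.
rewrite ipDr//; [|exact: sqZ|exact: fdim_sq Vc].
rewrite ipZr// el mulr0 add0r ipBl//; [|exact: sqZ|exact: fdim_sq Vc].
by rewrite ipZl ?dV ?ut ?mulr0 ?subr0//; exact: fdim_sq Vc.
Qed.

(** Linearity is asked on square-integrable functions only, because [prim] is linear only where the
    integrals exist. *)
Lemma fdim_image V (T : (R -> R) -> R -> R) : fdim V ->
  (forall f, sq f -> sq (T f)) ->
  (forall c f g, sq f -> sq g ->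
    T (fun x => c * f x + g x) = (fun x => c * T f x + T g x)) ->
  fdim (T @` V).
Proof.
move=> fV Tsq Tlin; elim: fV => [|f {}V sf fV ih].
  rewrite image_set1 (_ : T (cst 0) = cst 0); first exact: fdim0.
  have := Tlin (-1) (cst 0) (cst 0) (sq_cst _ _ _) (sq_cst _ _ _).
  rewrite (_ : (fun x => _ * cst 0 x + _) = cst 0).
    by move=> ->; apply/funext => x /=; ring.
  by apply/funext => x /=; rewrite mulr0 addr0.
rewrite (_ : T @` _ = adjoin (T f) (T @` V)).
  by apply: fdimS => //; exact: Tsq.
apply/seteqP; split => [_ [_ [c [k [Vk ->]]] <-]|_ [c [_ [[k Vk <-] ->]]]].
  by exists c, (T k); split; [exists k|rewrite Tlin//; exact: fdim_sq Vk].
exists (fun x => c * f x + k x); first by exists c, k.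
by rewrite Tlin//; exact: fdim_sq Vk.
Qed.

(** If the new generator [f] can be corrected by some [k0] in [V] to have [l (f + k0) = 0], then
    [f + k0] generates the rest of the kernel. If not, no element of the kernel has a nonzero
    coefficient on [f], since dividing by that coefficient would yield such a correction. *)
Lemma fdim_kernel V (l : (R -> R) -> R) : fdim V ->
  (forall c f g, sq f -> sq g -> l (fun x => c * f x + g x) = c * l f + l g) ->
  fdim (V `&` [set f | l f = 0]).
Proof.
move=> fV lin.
have l0 : l (cst 0) = 0.
  have := lin (-1) (cst 0) (cst 0) (sq_cst _ _ _) (sq_cst _ _ _).
  rewrite (_ : (fun x => _ * cst 0 x + _) = cst 0); first by move=> ->; ring.
  by apply/funext => x /=; rewrite mulr0 addr0.
elim: fV => [|f {}V sf fV ih].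
  rewrite (_ : _ `&` _ = [set cst 0]); first exact: fdim0.
  by apply/seteqP; split => [g []//|g ->].
have sV k : V k -> sq k by exact: fdim_sq.
have [[k0 [Vk0 lk0]]|nk] := pselect (exists k, V k /\ l f + l k = 0).
  rewrite (_ : _ `&` _ =
      adjoin (fun x => f x + k0 x) (V `&` [set f | l f = 0])).
    by apply: fdimS => //; apply: sqD => //; exact: sV.
  have lfk0 : l (fun x => f x + k0 x) = 0.
    rewrite (_ : (fun _ => _) = (fun x => 1 * f x + k0 x)).
      by rewrite lin ?mul1r//; exact: sV.
    by apply/funext => x; rewrite mul1r.
  have sfk0 : sq (fun x => f x + k0 x) by apply: sqD => //; exact: sV.
  apply/seteqP; split.
    move=> _ [[c [k [Vk ->]]] /=]; rewrite lin//; last exact: sV.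
    move=> lck; exists c, (fun x => - c * k0 x + k x); split.
      split; first exact: fdim_lin.
      rewrite /= lin; [|exact: sV..]; rewrite -lck.
      by rewrite (_ : l k0 = - l f); [ring|lra].
    by apply/funext => x; ring.
  move=> _ [c [k [[Vk /= lk] ->]]]; split => /=.
    exists c, (fun x => c * k0 x + k x); split; first exact: fdim_lin.
    by apply/funext => x; ring.
  by rewrite lin ?lfk0 ?lk ?mulr0 ?addr0//; exact: sV.
rewrite (_ : _ `&` _ = V `&` [set f | l f = 0])//.
apply/seteqP; split => [_ [[c [k [Vk ->]]] /=]|g [Vg lg]]; last first.
  split => //; exists 0, g; split => //.
  by apply/funext => x; rewrite mul0r add0r.
rewrite lin//; last exact: sV.
have [->|c0 lck] := eqVneq c 0.
  rewrite mul0r add0r => lk; rewrite (_ : (fun _ => _) = k)//.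
  by apply/funext => x; rewrite mul0r add0r.
exfalso; apply: nk; exists (fun x => c^-1 * k x); split.
  exact: fdim_scale.
rewrite (_ : (fun _ => _) = (fun x => c^-1 * k x + cst 0 x)); last first.
  by apply/funext => x; rewrite /= addr0.
rewrite lin ?l0 ?addr0//; [|exact: sV|exact: sq_cst].
by apply: (mulfI c0); rewrite mulrDr mulr0 mulrA divff// mul1r.
Qed.

End FiniteDimension.

(** * Spline spaces and the approximation estimate *)

Section SplineApproximation.
Context {R : realType}.
Variables (a b h : R) (n : nat).
Hypotheses (h0 : 0 < h) (n0 : (0 < n)%N) (hn : b = a + h * n%:R).
Notation mu := (@lebesgue_measure R).
Notation ip := (ip a b).
Notation sq := (sq a b).
Notation itg := (itg a b).
Notation prim := (prim a b).
Implicit Types (f g k s v : R -> R) (c x y : R) (j r : nat).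

Let ab : a < b.
Proof. by rewrite hn ltrDl mulr_gt0// ltr0n. Qed.

Definition knot j : R := a + h * j%:R.

Let knotS j : knot j.+1 = knot j + h.
Proof. by rewrite /knot -natr1; ring. Qed.

Let knot_ge j : a <= knot j.
Proof. by rewrite lerDl mulr_ge0// ltW. Qed.

Let knot_le j : (j <= n)%N -> knot j <= b.
Proof. by move=> jn; rewrite hn lerD2l ler_pM2l// ler_nat. Qed.

Definition cell j : set R := `]knot j, knot j.+1].

(** The generator [cst 1] makes the constants members as functions on all of R, not only on the
    cells. *)
Fixpoint step_space j : set (R -> R) :=
  if j is j'.+1 then adjoin \1_(cell j') (step_space j')
  else adjoin (cst 1) [set cst 0].

(* The splines of degree r whose derivatives of odd order below r (for
   even = true), or of even order below r (for even = false), vanish at a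
   and b: their derivatives are such splines for the opposite parity. *)
Fixpoint spline_sp (even : bool) r : set (R -> R) :=
  if r is r'.+1 then
    if even then adjoin (cst 1) (prim @` spline_sp false r')
    else prim @` (spline_sp true r' `&` [set s | prim s b = 0])
  else step_space n.

Lemma fdim_step_space j : fdim a b (step_space j).
Proof.
elim: j => [|j ih] /=; apply: fdimS => //; first exact: sq_cst.
  exact: fdim0.
apply: (@sq_bounded _ _ _ _ 1) => //.
  by apply: measurable_indic; exact: measurable_itv.
by move=> x _; rewrite indicE ger0_norm//; case: (_ \in _).
Qed.

Lemma prim_lin c f g : sq f -> sq g ->
  prim (fun x => c * f x + g x) = (fun x => c * prim f x + prim g x).
Proof.
move=> /sq_itg fi /sq_itg gi; apply/funext => x.
by rewrite primD ?primZ//; exact: itgZ.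
Qed.

Lemma fdim_spline_sp e r : fdim a b (spline_sp e r).
Proof.
elim: r e => [e|r ih e] /=; first exact: fdim_step_space.
have fi V : fdim a b V -> fdim a b (prim @` V).
  move=> fV; apply: (fdim_image fV) => [f /sq_itg|]; first exact: (sq_prim ab).
  exact: prim_lin.
case: e.
  by apply: fdimS; [exact: sq_cst|exact: fi].
apply/fi/fdim_kernel => // c f g sf sg.
by rewrite prim_lin.
Qed.

Lemma adjoin_self f V : fdim a b V -> adjoin f V f.
Proof.
move=> fV; exists 1, (cst 0); split; first exact: (fdim_cst0 fV).
by apply/funext => x; rewrite /= mul1r addr0.
Qed.

Lemma adjoin_sub f g V : V g -> adjoin f V g.
Proof.
move=> Vg; exists 0, g; split => //.
by apply/funext => x; rewrite mul0r add0r.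
Qed.

Lemma step_space_cst1 j : step_space j (cst 1).
Proof.
elim: j => [|j ih]; last exact: adjoin_sub.
by apply: adjoin_self; exact: fdim0.
Qed.

(** Used twice: a projection error orthogonal to even splines has mean 0, and an integration
    constant may be added to an even spline. *)
Lemma spline_sp_cst1 r : spline_sp true r (cst 1).
Proof.
case: r => [|r]; first exact: step_space_cst1.
apply: adjoin_self.
apply: (fdim_image (fdim_spline_sp _ _)) => [f /sq_itg|]; first exact: (sq_prim ab).
exact: prim_lin.
Qed.

(** Vanishing to the right of the last knot carries the induction: on the next cell only the new
    indicator contributes. *)
Lemma step_space_interpolation (w : nat -> R) j : exists2 s, step_space j s &
  (forall i x, (i < j)%N -> cell i x -> s x = w i) /\
  (forall x, knot j < x -> s x = 0).
Proof.
elim: j => [|j [s Vs [sw s0]]].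
  exists (cst 0) => //; exists 0, (cst 0); split => //.
  by apply/funext => x /=; rewrite mulr1 addr0.
exists (fun x => w j * \1_(cell j) x + s x); first by exists (w j), s.
split => [i x|x]; last first.
  move=> jx; rewrite s0 ?indicE ?memNset ?mulr0 ?addr0//.
    by rewrite /cell/= in_itv/= => /andP[_]; rewrite leNgt jx.
  by rewrite (le_lt_trans _ jx)// knotS lerDl ltW.
rewrite ltnS leq_eqVlt => /predU1P[->|ij] xi.
  rewrite indicE mem_set// mulr1 s0 ?addr0//.
  by move: xi; rewrite /cell/= in_itv => /andP[].
rewrite (sw _ _ ij xi) indicE memNset ?mulr0 ?add0r//.
move: xi; rewrite /cell/= !in_itv/= => /andP[_ xi] /andP[+ _].
rewrite ltNge (le_trans xi)// /knot lerD2l ler_pM2l//.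
by rewrite ler_nat.
Qed.

(** Let M be the integral of v. The claim follows by integrating ((y - x) v - M)^2 / (y - x) >=
    0. *)
Lemma cauchy_schwarz_itv v x y : x <= y ->
  mu.-integrable `]x, y] (EFin \o v) ->
  mu.-integrable `]x, y] (EFin \o (fun t => v t ^+ 2)) ->
  (\int[mu]_(t in `]x, y]) v t) ^+ 2 <=
  (y - x) * \int[mu]_(t in `]x, y]) (v t ^+ 2).
Proof.
rewrite le_eqVlt => /predU1P[->|xy] vi v2i.
  by rewrite set_itvoc0 !Rintegral_set0 expr0n/= mulr0.
set M := \int[mu]_(t in _) v t; set Q := \int[mu]_(t in _) _.
have L0 : 0 < y - x by rewrite subr_gt0.
have muL : fine (mu `]x, y]) = y - x.
  by rewrite lebesgue_measure_itv/= lte_fin xy.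
have m1 : measurable (`]x, y] : set R) by exact: measurable_itv.
have ci c : mu.-integrable `]x, y] (EFin \o cst c).
  apply: measurable_bounded_integrable => //.
    by rewrite /= lebesgue_measure_itv/= lte_fin xy -EFinB ltry.
  by exists `|c|; split => // N cN t _; exact: ltW.
have zi c f : mu.-integrable `]x, y] (EFin \o f) ->
  mu.-integrable `]x, y] (EFin \o (fun t => c * f t)).
  by move=> fi; exact: (integrableZl _ c fi).
have : 0 <= \int[mu]_(t in `]x, y])
    ((y - x) * v t ^+ 2 + ((- (2 * M)) * v t + (y - x)^-1 * M ^+ 2)).
  apply: Rintegral_ge0 => t _.
  rewrite [leRHS](_ : _ = (y - x)^-1 * ((y - x) * v t - M) ^+ 2).
    by rewrite mulr_ge0 ?sqr_ge0// invr_ge0 ltW.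
  by field; rewrite gt_eqF.
rewrite RintegralD//; [|exact: zi|]; last first.
  by exact: (integrableD _ (zi _ _ vi) (ci _)).
rewrite RintegralD//; [|exact: zi|exact: ci].
rewrite Rintegral_cst// RintegralZl// RintegralZl// muL -/M -/Q.
by rewrite mulrAC mulVf ?gt_eqF// mul1r; nra.
Qed.

(** The error at a point x of a cell is the integral of v from the left knot to x, so by
    Cauchy-Schwarz its square is at most h times the integral of v^2 over the cell. Integrating over
    the cell gives the second factor h. *)
Lemma step_approximation v : sq v -> exists2 s, step_space n s &
  ip (fun x => prim v x - s x) (fun x => prim v x - s x) <= h ^+ 2 * ip v v.
Proof.
move=> sv; have vi := sq_itg sv.
have [s Vs [sw _]] := step_space_interpolation (prim v \o knot) n.
exists s => //.
have ss := fdim_sq (fdim_step_space n) Vs.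
pose E x := (prim v x - s x) ^+ 2; pose v2 x := v x ^+ 2.
have Ei : itg E by exact: (sqB (sq_prim ab vi) ss).2.
have v2i : itg v2 by exact: sv.2.
have itS f x y : itg f -> a <= x -> y <= b ->
    mu.-integrable `]x, y] (EFin \o f).
  move=> fi ax yb; apply: integrableS fi => //; apply: subset_itv => //.
(* The sum over the cells takes the form of an induction on the knot up to which both sides are
   integrated. *)
suff H j : (j <= n)%N -> prim E (knot j) <= h ^+ 2 * prim v2 (knot j).
  have kb : knot n = b by rewrite hn.
  have := H n (leqnn n); rewrite kb /prim minxx.
  by congr (_ <= _ * _).
elim: j => [_|j ih jn].
  by rewrite /knot mulr0 addr0 !prim_a// mulr0.
have /ih {}ih : (j <= n)%N by exact: ltnW.
have kb := knot_le jn; have kk : knot j <= knot j.+1 by rewrite knotS lerDl ltW.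
have := prim_sub Ei (knot_ge j) kk kb.
have := prim_sub v2i (knot_ge j) kk kb.
set A := \int[mu]_(t in _) v2 t; set B := \int[mu]_(t in _) E t => hA hB.
suff : B <= h ^+ 2 * A by rewrite -hA -hB; nra.
(* As the cell has length [h], the bound becomes the integral of the constant [h * A], and it
   suffices to compare integrands. *)
have -> : h ^+ 2 * A = \int[mu]_(t in `]knot j, knot j.+1]) (h * A).
  rewrite Rintegral_cst//.
  rewrite /= lebesgue_measure_itv/= lte_fin knotS ltrDl h0/=.
  by rewrite expr2 -mulrA mulrC; congr (_ * _); ring.
apply: le_Rintegral => //; [exact: itS|exact: (itS _ _ _ (itg_cst _ _ _))|].
move=> x xj; rewrite /E (sw j)//.
move: xj; rewrite /= in_itv/= => /andP[jx xj].
have xb := le_trans xj kb.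
rewrite (prim_sub vi (knot_ge j) (ltW jx) xb).
apply: le_trans (cauchy_schwarz_itv (ltW jx) _ _) _; [exact: itS|exact: itS|].
apply: ler_pM.
- by rewrite subr_ge0 ltW.
- by apply: Rintegral_ge0 => t _; exact: sqr_ge0.
- by rewrite lerBlDl (le_trans xj)// knotS.
rewrite -(prim_sub v2i (knot_ge j) (ltW jx) xb) /A.
rewrite -(prim_sub v2i (knot_ge j) kk kb) lerD2r -subr_ge0.
rewrite (prim_sub v2i (le_trans (knot_ge j) (ltW jx)) xj kb).
by apply: Rintegral_ge0 => t _; exact: sqr_ge0.
Qed.

(* The hypothesis at b kills the boundary terms when integrating (E, E) by
   parts, which gives |E|^2 = - (e, prim E). *)
Lemma duality V (C : R) e E c : 0 < C -> fdim a b V -> sq e -> sq E ->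
  {in `[a, b], forall x, E x = prim e x - c} -> (prim e b - c) * prim E b = 0 ->
  (forall g, V g -> ip e g = 0) ->
  (exists2 t, V t &
    ip (fun x => prim E x - t x) (fun x => prim E x - t x) <= C * ip E E) ->
  ip E E <= C * ip e e.
Proof.
move=> C0 fV se sE EE Eb0 eV [t Vt ZtE].
have sZ := sq_prim ab (sq_itg sE); have st := fdim_sq fV Vt.
pose d x := prim E x - t x.
have sd : sq d by exact: sqB.
have ipEE : ip E E = ip (prim e) E - c * prim E b.
  rewrite prim_b (ipC _ _ E (cst 1)) -ipZl//; last exact: sq_cst.
  rewrite -ipBl//; [|exact: (sq_prim ab (sq_itg se))|exact: (sqZ c (sq_cst _ _ 1))].
  by apply: eq_ip => // x /EE ->; rewrite mulr1.
have EEed : ip E E = - ip e d.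
  rewrite /d ipBr// (eV _ Vt) subr0 ipEE (ipC _ _ _ E) (ip_prim ab)//.
  by rewrite mulrC -[RHS]addr0 -Eb0; ring.
rewrite -/d in ZtE; clearbody d.
have sCe : sq (fun x => C * e x) by exact: sqZ.
(* Expanding |C e + d|^2 >= 0 with (e, d) = - |E|^2 and |d|^2 <= C |E|^2 gives C |E|^2 <= C^2 |e|^2,
   with no square roots involved. *)
have := @ip_ge0 _ a b (fun x => C * e x + d x).
rewrite ipDl//; last exact: sqD.
rewrite !ipDr// !ipZl// !ipZr// (ipC _ _ d e) => H.
have H2 : 0 <= C * (C * ip e e - ip E E) by nra.
by rewrite -subr_ge0 -(pmulr_rge0 _ C0).
Qed.

(** The parities are treated together, since each step calls the induction hypothesis for the
    opposite one. In the odd case [prim v] must vanish at b, as the odd splines of positive degree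
    do. *)
Lemma spline_approximation (even : bool) r v : sq v -> even \/ prim v b = 0 ->
  exists2 s, spline_sp even r s &
  ip (fun x => prim v x - s x) (fun x => prim v x - s x) <= h ^+ 2 * ip v v.
Proof.
have h20 : 0 < h ^+ 2 by rewrite exprn_gt0.
elim: r even v => [e v sv _|r ih even v sv ev]; first exact: step_approximation.
have [t Vt tP] := fdim_projection (fdim_spline_sp (~~ even) r) sv.
have fV := fdim_spline_sp (~~ even) r.
have st := fdim_sq fV Vt; have [vi ti] := (sq_itg sv, sq_itg st).
pose e x := v x - t x; have se : sq e by exact: sqB.
have pe : prim e =1 (fun x => prim v x - prim t x).
  by move=> x; rewrite /e primB.
(* Pythagoras, as [e] is orthogonal to [t]. *)
have le_ev : ip e e <= ip v v.
  have := @ip_ge0 _ a b t; have := tP t Vt; rewrite ipBl// ipB_sqr//; lra.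
have spe : sq (prim e) by exact: sq_prim (sq_itg se).
case: even ev fV Vt tP => /= ev fV Vt tP.
(* Subtracting the mean [c] of [prim e] makes the primitive of [E] vanish at b, which is the
   condition under which the induction hypothesis for odd splines applies. *)
- pose c := prim (prim e) b / (b - a).
  pose E x := prim e x - c.
  have sE : sq E by apply: sqB spe (sq_cst _ _ c).
  exists (fun x => c * cst 1 x + prim t x).
    by exists c, (prim t); split => //; exists t.
  have -> : (fun x => prim v x - (c * cst 1 x + prim t x)) = E.
    by apply/funext => x; rewrite /E pe /=; ring.
  have Eb : prim E b = 0.
    rewrite primB; [|exact: sq_itg|exact: itg_cst].
    rewrite [X in _ - X](_ : _ = c * (b - a)); last first.
      rewrite /prim minxx Rintegral_cst//.
      by rewrite /= lebesgue_measure_itv/= lte_fin ab.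
    by rewrite /c divfK ?subrr// subr_eq0 gt_eqF.
  apply: le_trans (ler_wpM2l (ltW h20) le_ev).
  apply: (@duality (spline_sp false r) _ e E c) => //.
  - by rewrite Eb mulr0.
  - by apply: ih => //; right.
- have vb : prim v b = 0 by case: ev.
  (* The constants are even splines, so [e] has mean 0. Hence so has [t], and [prim t] belongs to
     the odd space. *)
  have eb : prim e b = 0.
    by rewrite prim_b; apply: tP; exact: spline_sp_cst1.
  have tb : prim t b = 0 by move: eb; rewrite pe vb; lra.
  exists (prim t); first by exists t.
  have -> : (fun x => prim v x - prim t x) = prim e.
    by apply/funext => x; rewrite pe.
  apply: le_trans (ler_wpM2l (ltW h20) le_ev).
  apply: (@duality (spline_sp true r) _ e (prim e) 0) => //.
  - by move=> x _; rewrite subr0.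
  - by rewrite eb subr0 mul0r.
  - by apply: ih => //; left.
Qed.

End SplineApproximation.

(** * Smooth functions that are flat at the origin *)

Section SmoothBump.
Context {R : realType}.
Implicit Types (P Q : {poly R}) (x y z c d : R) (f g : R -> R).

(** The polynomial factor in 1/y makes the family closed under differentiation. *)
Definition bump P y : R := if 0 < y then P.[y^-1] * expR (- y^-1) else 0.

(** The free exponent [k] carries the induction on [P]: a factor X of the polynomial is absorbed
    into [z ^+ k]. Monomials are bounded by a single term of the exponential series. *)
Lemma horner_le_expR P k : exists2 C, 0 <= C &
  forall z, 0 <= z -> `|P.[z]| * z ^+ k <= C * expR z.
Proof.
have zk z m : 0 <= z -> z ^+ m <= m`!%:R * expR z.
  case: m => [|m] z0.
    by rewrite expr0 fact0 mul1r -expR0 ler_expR.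
  rewrite mulrC -ler_pdivrMr ?ltr0n ?fact_gt0//.
  by apply: le_trans (expR_ge1Dxn m z0); rewrite lerDr.
elim/poly_ind: P k => [|P c ih] k.
  by exists 0 => // z _; rewrite horner0 normr0 !mul0r.
have [C C0 CP] := ih k.+1; exists (C + `|c| * k`!%:R).
  by rewrite addr_ge0// mulr_ge0.
move=> z z0; rewrite hornerMXaddC mulrDl.
apply: (@le_trans _ _ ((`|P.[z]| * z + `|c|) * z ^+ k)).
  rewrite ler_wpM2r ?exprn_ge0//; apply: le_trans (ler_normD _ _) _.
  by rewrite normrM (ger0_norm z0).
rewrite mulrDl -mulrA -exprS lerD ?CP// -mulrA ler_wpM2l//.
exact: zk.
Qed.

(** The quadratic bound forces the difference quotient at 0 to tend to 0. *)
Lemma bump_le_sqr P : exists2 C, 0 <= C & forall y, `|bump P y| <= C * y ^+ 2.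
Proof.
have [C C0 CP] := horner_le_expR P 2.
exists C => // y; rewrite /bump; case: ifPn => [y0|_]; last first.
  by rewrite normr0 mulr_ge0// sqr_ge0.
have yV : 0 <= y^-1 by rewrite invr_ge0 ltW.
rewrite normrM (ger0_norm (expR_ge0 _)) expRN ler_pdivrMr ?expR_gt0//.
rewrite mulrAC -ler_pdivrMr ?exprn_gt0// -exprVn.
exact: CP.
Qed.

(** For positive y, differentiating P(1/y) and exp(-1/y) produces the terms with P' and P, each with
    a factor 1/y^2; this factor is the X^2. *)
Lemma is_derive_bump P y :
  is_derive y 1 (bump P) (bump ('X^2 * (P - P^`())) y).
Proof.
have [y0|y0|->] := ltgtP y 0.
- rewrite /(bump (_ * _)) ltNge (ltW y0)/=.
  apply: (@near_eq_is_derive _ _ _ (cst 0)).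
  near=> x; rewrite /bump ltNge /= ltW//; near: x; exact: lt_nbhsl.
- apply: (@near_eq_is_derive _ _ _ (fun x => P.[x^-1] * expR (- x^-1))).
    near=> x; rewrite /bump ifT//; near: x; exact: lt_nbhsr.
  have yn0 : y != 0 by rewrite gt_eqF.
  have dV : is_derive y 1 (fun x : R => x^-1) (- y ^- 2).
    have := is_deriveV yn0 (is_derive_id y (1 : R)).
    by rewrite /GRing.scale/= mulr1.
  have dP := is_derive1_comp (is_derive_poly P y^-1) dV.
  have dE := @is_derive1_comp _ _ (fun x => - x^-1) _ _ _
    (is_derive_expR (- y^-1)) (is_deriveN dV).
  have dPE : is_derive y 1 (fun x : R => P.[x^-1] * expR (- x^-1)) _ :=
    is_deriveM dP dE.
  apply: (is_derive_eq dPE); rewrite /GRing.scale/= /bump y0 hornerM hornerXn hornerD hornerN.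
  by rewrite exprVn /=; ring.
- rewrite /(bump (_ * _)) ltxx.
  have [C C0 CP] := bump_le_sqr P.
  have H : h^-1 *: ((bump P \o shift 0) (h *: (1:R)) - bump P 0)
      @[h --> (0:R)^'] --> (0 : R).
    apply/cvgrPdist_le => /= e e0; near=> h.
    have h0 : h != 0 by near: h; exact: nbhs_dnbhs_neq.
    rewrite sub0r normrN addr0 /GRing.scale/= mulr1 {2}/bump ltxx subr0.
    rewrite normrM normfV ler_pdivrMl ?normr_gt0//.
    apply: le_trans (CP h) _; rewrite -[h ^+ 2]ger0_norm ?sqr_ge0// normrX.
    rewrite expr2 mulrCA ler_pM2l ?normr_gt0//.
    have : `|h| <= e / (C + 1).
      by near: h; apply: dnbhs0_le; rewrite divr_gt0// ltr_wpDl.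
    rewrite ler_pdivlMr ?ltr_wpDl// mulrDr mulr1 mulrC; have := normr_ge0 h; lra.
  apply: DeriveDef; first exact: (cvgP _ H).
  exact: (cvg_lim _ H).
Unshelve. all: by end_near. Qed.

End SmoothBump.

(** * Smooth functions and mollified indicators *)

Section TestFunctions.
Context {R : realType}.
Implicit Types (P Q : {poly R}) (x y z c d : R) (f g : R -> R).

Definition smooth f : Prop := forall n x, derivable (derive1n n f) x 1.

(** A coinduction principle: it is enough to exhibit a class closed under differentiation, without
    formulas for iterated derivatives. *)
Lemma smooth_coind (C : set (R -> R)) :
  (forall f, C f -> exists2 g, C g & forall x, is_derive x 1 f (g x)) ->
  forall f, C f -> smooth f.
Proof.
move=> CC f Cf n; have : C (derive1n n f).
  elim: n => [//|n /CC [g Cg dg]].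
  rewrite derive1nS (_ : derive1 _ = g)//.
  by apply/funext => x; rewrite derive1E derive_val.
by move=> /CC [g _ dg] x; exact: ex_derive.
Qed.

Lemma smooth_derive f x : smooth f -> is_derive x 1 f (derive1 f x).
Proof. by move=> /(_ 0%N x) df; rewrite derive1E; exact: derivableP. Qed.

Lemma smooth_derive1 f : smooth f -> smooth (derive1 f).
Proof. by move=> sf n x; rewrite -derive1Sn; exact: sf. Qed.

Lemma smooth_continuous f : smooth f -> continuous f.
Proof.
move=> sf x; apply: differentiable_continuous.
exact/derivable1_diffP/(sf 0%N).
Qed.

Lemma smoothD f g c : smooth f -> smooth g -> smooth (fun x => f x + c * g x).
Proof.
move=> sf sg; pose C := [set u | exists f g, [/\ smooth f, smooth g &
  u = (fun x : R => f x + c * g x)]].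
apply: (@smooth_coind C); last by exists f, g.
move=> _ [{sf}f [{sg}g [sf sg ->]]].
exists (fun x => derive1 f x + c * derive1 g x).
  by exists (derive1 f), (derive1 g); split => //; exact: smooth_derive1.
move=> x; exact: (is_deriveD (smooth_derive x sf) (is_deriveZ c (smooth_derive x sg))).
Qed.

Lemma smooth_primitive f g : smooth g -> (forall x, is_derive x 1 f (g x)) ->
  smooth f.
Proof.
move=> sg fg; apply: (@smooth_coind ([set f] `|` smooth)); last by left.
move=> u [->|su]; first by exists g => //; right.
by exists (derive1 u); [right; exact: smooth_derive1|move=> x; exact: smooth_derive].
Qed.

(** A pointwise form of the support condition, stable under linear combinations and primitives; it
    implies [test_function] once [c, d] lies inside (a, b). *)
Definition stest c d f : Prop :=
  smooth f /\ forall x, (x <= c) || (d <= x) -> f x = 0.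

Lemma stest_test_function a b c d f : a < c -> d < b -> stest c d f ->
  test_function a b f.
Proof.
move=> ac db [sf f0].
have cl : closure [set x | f x != 0] `<=` `[c, d].
  rewrite [X in _ `<=` X](closure_id _).1; last exact: itv_closed.
  apply: closureS => x /=; rewrite in_itv/= => fx.
  by apply/andP; split; rewrite leNgt; apply: contra fx => /ltW h;
    rewrite f0 ?h ?orbT.
split => //.
  by apply: subclosed_compact cl; [exact: closed_closure|exact: segment_compact].
by apply: subset_trans cl _; apply: subset_itv; rewrite bnd_simp.
Qed.

(** Dilation by [m.+1] drives each factor to 1 where its argument is positive and leaves it 0
    elsewhere. *)
Definition mollifier c d (m : nat) x : R :=
  bump 1 (m.+1%:R * (x - c)) * bump 1 (m.+1%:R * (d - x)).

(* A class of functions that is closed under differentiation. *)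
Inductive bump_sum c d k : (R -> R) -> Prop :=
| bump_sum_prod P Q : bump_sum c d k
    (fun x => bump P (k * (x - c)) * bump Q (k * (d - x)))
| bump_sum_lin f g l : bump_sum c d k f -> bump_sum c d k g ->
    bump_sum c d k (fun x => l * f x + g x).

Lemma smooth_bump_sum c d k f : bump_sum c d k f -> smooth f.
Proof.
apply: smooth_coind => {}f; elim=> {f} [P Q|f g l _ [f' Cf f'f] _ [g' Cg g'g]].
  have [P' dP] : exists P', forall y, is_derive y 1 (bump P) (bump P' y).
    by eexists => y; exact: is_derive_bump.
  have [Q' dQ] : exists Q', forall y, is_derive y 1 (bump Q) (bump Q' y).
    by eexists => y; exact: is_derive_bump.
  (* The last two terms cancel and only give the sum the shape of [bump_sum]. *)
  exists (fun x => k * (bump P' (k * (x - c)) * bump Q (k * (d - x))) +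
    ((- k) * (bump P (k * (x - c)) * bump Q' (k * (d - x))) +
     ((-1) * (bump P (k * (x - c)) * bump Q (k * (d - x))) +
       bump P (k * (x - c)) * bump Q (k * (d - x))))).
    by do 3! (apply: bump_sum_lin; first exact: bump_sum_prod);
      exact: bump_sum_prod.
  move=> x.
  have d1 : is_derive x 1 (fun x : R => k * (x - c)) k.
    apply: (is_derive_eq (is_deriveZ k
      (is_deriveB (is_derive_id x (1:R)) (is_derive_cst c x (1:R))))).
    by rewrite subr0 /GRing.scale/= mulr1.
  have d2 : is_derive x 1 (fun x : R => k * (d - x)) (- k).
    apply: (is_derive_eq (is_deriveZ k
      (is_deriveB (is_derive_cst d x (1:R)) (is_derive_id x (1:R))))).
    by rewrite sub0r /GRing.scale/= mulrN1.
  have e1 := is_derive1_comp (dP _) d1; have e2 := is_derive1_comp (dQ _) d2.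
  apply: (is_derive_eq (is_deriveM e1 e2)); rewrite /GRing.scale/=; ring.
exists (fun x => l * f' x + g' x); first exact: bump_sum_lin.
by move=> x; exact: (is_deriveD (is_deriveZ l (f'f x)) (g'g x)).
Qed.

Lemma stest_mollifier c d m : stest c d (mollifier c d m).
Proof.
split; first exact: smooth_bump_sum (bump_sum_prod c d m.+1%:R 1 1).
move=> x /orP[xc|dx]; rewrite /mollifier.
  by rewrite {1}/bump ltNge mulr_ge0_le0// ?mul0r// subr_le0.
by rewrite {2}/bump ltNge mulr_ge0_le0// ?mulr0// subr_le0.
Qed.

Lemma bump1_ge0_le1 y : 0 <= bump (1 : {poly R}) y <= 1.
Proof.
rewrite /bump; case: ifP => y0; last by rewrite lexx ler01.
rewrite hornerC mul1r expR_ge0/= -expR0 ler_expR oppr_le0 invr_ge0.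
exact: ltW.
Qed.

Lemma mollifier_ge0_le1 c d m x : 0 <= mollifier c d m x <= 1.
Proof.
have /andP[h1 h2] := bump1_ge0_le1 (m.+1%:R * (x - c)).
have /andP[h3 h4] := bump1_ge0_le1 (m.+1%:R * (d - x)).
by rewrite /mollifier mulr_ge0//= mulr_ile1.
Qed.

Lemma cvg_bump1 y : 0 < y ->
  bump (1 : {poly R}) (m.+1%:R * y) @[m --> \oo] --> (1 : R).
Proof.
move=> y0.
rewrite (_ : (fun _ => _) = (fun m => expR (- y^-1 * m.+1%:R^-1))); last first.
  apply/funext => m; rewrite /bump mulr_gt0 ?ltr0n// hornerC mul1r.
  by rewrite invfM mulNr mulrC.
rewrite -[X in _ --> X]expR0; apply: continuous_cvg; first exact: continuous_expR.
rewrite -[X in _ --> X](mulr0 (- y^-1)); apply: cvgMl_tmp.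
exact: cvg_harmonic.
Qed.

End TestFunctions.

(** * The fundamental lemma of the calculus of variations *)

Section FundamentalLemma.
Context {R : realType}.
Variables a b : R.
Hypothesis ab : a < b.
Notation mu := (@lebesgue_measure R).
Notation ip := (ip a b).
Notation sq := (sq a b).
Notation itg := (itg a b).
Notation prim := (prim a b).
Implicit Types (f g : R -> R) (c d x y : R).

Lemma sq_smooth f : smooth f -> sq f.
Proof.
move=> /smooth_continuous cf; apply: sq_continuous.
exact: continuous_subspaceT.
Qed.

Lemma cvg_mollifier c d x :
  mollifier c d m x @[m --> \oo] --> (\1_(`]c, d[ : set R) x : R).
Proof.
rewrite indicE; have [/set_mem/=|/negP xcd] := boolP (x \in _).
  rewrite in_itv/= => /andP[cx xd]; rewrite -[X in _ --> X]mulr1.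
  by apply: cvgM; apply: cvg_bump1; rewrite subr_gt0.
rewrite (_ : (fun _ => _) = cst 0); first exact: cvg_cst.
apply/funext => m; apply: (stest_mollifier c d m).2.
rewrite !leNgt -negb_and; apply/negP => h; apply: xcd.
by rewrite inE/= in_itv.
Qed.

(** Dominated convergence with majorant |f|, as mollifiers take values in [0, 1]. *)
Lemma ip_mollifier_cvg f c d : itg f ->
  ip f (mollifier c d m) @[m --> \oo] --> ip f \1_(`]c, d[ : set R).
Proof.
move=> fi; have mf := itg_measurable fi.
have m1 m : measurable_fun `[a, b] (mollifier c d m : R -> R).
  exact: (sq_smooth (stest_mollifier c d m).1).1.
have m2 : measurable_fun `[a, b] (\1_(`]c, d[ : set R) : R -> R).
  by apply: measurable_indic; exact: measurable_itv.
have [] := @dominated_convergence _ _ _ mu `[a, b]%classic _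
  (fun m x => (f x * mollifier c d m x)%:E)
  (fun x => (f x * \1_(`]c, d[ : set R) x)%:E)
  (fun x => `|f x|%:E).
- exact: measurable_itv.
- by move=> m; apply/measurable_EFinP; exact: (measurable_funM mf (m1 m)).
- by apply/measurable_EFinP; exact: (measurable_funM mf m2).
- apply: aeW => x _; apply: cvg_EFin; first exact: nearW.
  by apply: cvgMl_tmp; exact: cvg_mollifier.
- by apply: integrable_norm.
- apply: aeW => x m _; rewrite /= lee_fin normrM ler_piMr//.
  by have /andP[h0 h1] := mollifier_ge0_le1 c d m x; rewrite ger0_norm.
move=> i1 _ H; apply: fine_cvg; rewrite fineK//.
exact: integrable_fin_num i1.
Qed.

Lemma ip_stest_eq0_itv f c d : itg f -> a < c -> c < d -> d < b ->
  (forall g, stest c d g -> ip f g = 0) -> prim f d = prim f c.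
Proof.
move=> fi ac cd db f0; apply/eqP; rewrite -subr_eq0.
rewrite prim_sub ?ltW//; apply/eqP.
have : mu.-integrable `]c, d[ (EFin \o f).
  by apply: integrableS fi => //; apply: subset_itv; rewrite bnd_simp ltW.
move=> /Rintegral_itv_bndo_bndc <-.
have -> : \int[mu]_(x in `]c, d[) f x = ip f \1_(`]c, d[ : set R).
  rewrite -[`]c, d[%classic](@setIidr _ `[a, b]%classic); last first.
    by apply: subset_itv; rewrite bnd_simp ltW.
  rewrite Rintegral_mkcondr; apply: eq_Rintegral => x _.
  by rewrite setIidr ?patch_indic//; apply: subset_itv; rewrite bnd_simp ltW.
have := @ip_mollifier_cvg f c d fi; rewrite (_ : (fun _ => _) = cst 0).
  by move=> H; exact: (cvg_unique (@Rhausdorff R) H (cvg_cst _)).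
by apply/funext => m; apply: f0; exact: stest_mollifier.
Qed.

(** By Lebesgue differentiation, almost every value of f is the derivative of its primitive, which
    is constant inside (a, b). Extending f by zero gives the local integrability on the whole line
    that [FTC1] asks for. *)
Lemma prim_const_ae0 f : itg f ->
  (forall x y, a < x -> x < y -> y < b -> prim f x = prim f y) ->
  {ae mu, forall x, x \in `]a, b[ -> f x = 0}.
Proof.
move=> fi fc; pose g := f \_ `[a, b].
have gi : mu.-integrable setT (EFin \o g).
  by rewrite -restrict_EFin; apply/integrable_restrict => //=; rewrite setTI.
have gy y : mu.-integrable [set` Interval (BLeft a) (BRight y)] (EFin \o g).
  by apply: integrableS gi => //; exact: measurable_itv.
have lg : locally_integrable setT g.
  by apply: open_integrable_locally => //; exact: openT.
have /= := FTC1 gy lg.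
apply: filterS; first exact: (ae_filter_ringOfSetsType mu).
move=> x xP xab.
move: (xab); rewrite in_itv/= => /andP[ax xb].
have [|_] := xP _; first by rewrite lte_fin.
rewrite /g patchE mem_set; last by exact: subset_itv_oo_cc xab.
move=> <-; rewrite derive1E; set F := fun y => _.
have : is_derive x 1 F 0; last by move=> dF; rewrite derive_val.
apply: (@near_eq_is_derive _ _ _ (cst (prim f x))).
near=> y; rewrite /cst /F.
have ay : a < y by near: y; exact: lt_nbhsr.
have yb : y < b by near: y; exact: lt_nbhsl.
transitivity (prim f y).
  by have [xy|yx|->//] := ltgtP x y; [exact: fc|apply/esym; exact: fc].
rewrite primE ?in_itv/= ?(ltW ay) ?(ltW yb)//.
apply: eq_Rintegral => t; rewrite inE/= in_itv/= => /andP[at_ ty].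
by rewrite patchE mem_set//= in_itv/= at_ (le_trans ty)// ltW.
Unshelve. all: by end_near. Qed.

Lemma ae_ip f g : sq f -> sq g ->
  {ae mu, forall x, x \in `]a, b[ -> f x = g x} -> ip f f = ip g g.
Proof.
move=> sf sg fg.
have oo k : sq k -> ip k k = \int[mu]_(x in `]a, b[) (k x * k x).
  move=> sk; rewrite Rintegral_itv_bndo_bndc ?Rintegral_itv_obnd_cbnd//.
    by apply: integrableS (sk.2) => //; exact: subset_itv_oc_cc.
  by apply: integrableS (sk.2) => //; exact: subset_itv_oo_cc.
have moo k : sq k -> measurable_fun `]a, b[ k.
  by move=> [mk _]; apply: measurable_funS mk => //; exact: subset_itv_oo_cc.
have [mf mg] := (moo _ sf, moo _ sg).
rewrite !oo//; congr fine; apply: ae_eq_integral => //.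
- by apply/measurable_EFinP; exact: (measurable_funM mf mf).
- by apply/measurable_EFinP; exact: (measurable_funM mg mg).
- apply: filterS fg; first exact: (ae_filter_ringOfSetsType mu).
  by move=> x fgx /fgx ->.
Qed.

Lemma ae_stest_eq0 f : itg f ->
  (forall c d g, a < c -> c < d -> d < b -> stest c d g -> ip f g = 0) ->
  {ae mu, forall x, x \in `]a, b[ -> f x = 0}.
Proof.
move=> fi f0; apply: prim_const_ae0 => // x y ax xy yb.
by apply/esym/ip_stest_eq0_itv => // g; exact: f0.
Qed.

End FundamentalLemma.

(** * Functions with vanishing weak derivative; primitives as weak antiderivatives *)

Section WeakDerivatives.
Context {R : realType}.
Variables a b : R.
Hypothesis ab : a < b.
Notation mu := (@lebesgue_measure R).
Notation ip := (ip a b).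
Notation sq := (sq a b).
Notation itg := (itg a b).
Notation prim := (prim a b).
Implicit Types (f g : R -> R) (c d x y : R) (k : nat).

Lemma prim_vanish f x : (forall y, y \in `[a, b] -> y <= x -> f y = 0) ->
  prim f x = 0.
Proof.
move=> f0; rewrite /prim (@eq_Rintegral _ _ _ _ _ (cst 0)) ?Rintegral_cst ?mul0r//.
move=> t; rewrite inE/= in_itv/= le_min => /and3P[at_ tx tb].
by apply: f0 => //; rewrite in_itv/= at_ tb.
Qed.

Lemma is_derive_prim f x : itg f -> a < x -> x < b -> {for x, continuous f} ->
  is_derive x 1 (prim f) (f x).
Proof.
move=> fi ax xb cf.
have [df f'] := continuous_FTC1_closed xb fi ax cf.
have : is_derive x 1 (fun y => \int[mu]_(t in `[a, y]) f t) (f x).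
  by apply: DeriveDef => //; rewrite -derive1E.
apply: near_eq_is_derive; near=> y; rewrite primE// in_itv/=; apply/andP; split.
  by apply: ltW; near: y; exact: lt_nbhsr.
by apply: ltW; near: y; exact: lt_nbhsl.
Unshelve. all: by end_near. Qed.

(** Mean 0 makes the primitive vanish beyond d as well as before c. Its derivative is found
    separately before c, beyond d, and on [c, d], where the integrand is continuous. *)
Lemma stest_prim c d f : a < c -> c < d -> d < b -> stest c d f ->
  prim f b = 0 -> stest c d (prim f) /\ derive1 (prim f) = f.
Proof.
move=> ac cd db [sf f0] pf.
have fi := sq_itg (sq_smooth a b sf).
have pc x : x <= c -> prim f x = 0.
  move=> xc; apply: prim_vanish => y _ yx.
  by rewrite f0// (le_trans yx).
have pd x : d <= x -> prim f x = 0.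
  move=> dx; have [bx|xb] := leP b x.
    by move: pf; rewrite /prim minxx min_r.
  have ax : a <= x by rewrite ltW// (lt_trans ac)// (lt_le_trans cd).
  have := prim_sub fi ax (ltW xb) (lexx b); rewrite pf.
  rewrite (@eq_Rintegral _ _ _ _ _ (cst 0)) ?Rintegral_cst ?mul0r//; first lra.
  move=> t; rewrite inE/= in_itv/= => /andP[xt _].
  by rewrite f0// (le_trans dx (ltW xt)) orbT.
have df x : is_derive x 1 (prim f) (f x).
  have [xc|cx] := ltP x c.
    rewrite f0 ?(ltW xc)//; apply: (@near_eq_is_derive _ _ _ (cst 0)).
    by near=> y; rewrite pc// ltW//; near: y; exact: lt_nbhsl.
  have [dx|xd] := ltP d x.
    rewrite f0 ?(ltW dx) ?orbT//; apply: (@near_eq_is_derive _ _ _ (cst 0)).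
    by near=> y; rewrite pd// ltW//; near: y; exact: lt_nbhsr.
  apply: is_derive_prim => //; [exact: lt_le_trans cx|exact: le_lt_trans db|].
  exact: smooth_continuous.
split; last by apply/funext => x; rewrite derive1E derive_val.
split; first exact: smooth_primitive df.
by move=> x /orP[/pc|/pd].
Unshelve. all: by end_near. Qed.

(** Otherwise the primitive of 1 would agree at the two points that divide (a, b) into thirds. *)
Lemma exists_stest_ip_neq0 : exists c d f,
  [/\ a < c, c < d, d < b, stest c d f & ip (cst 1) f != 0].
Proof.
apply: contrapT => H; pose t : R := (b - a) / 3.
have t0 : 0 < t by rewrite divr_gt0// subr_gt0.
have bE : b = a + 3 * t by rewrite /t; field.
have : prim (cst 1) (a + 2 * t) = prim (cst 1) (a + t).
  apply: ip_stest_eq0_itv; rewrite ?bE; [exact: itg_cst|lra..|].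
  move=> g gt; rewrite -bE; apply: contrapT => /eqP g0; apply: H.
  by exists (a + t), (a + 2 * t), g; split => //; rewrite ?bE; lra.
have px x : a < x -> x < b -> prim (cst 1) x = x - a.
  move=> ax xb; rewrite primE ?in_itv/= ?(ltW ax) ?(ltW xb)// Rintegral_cst//.
  by rewrite /= lebesgue_measure_itv/= lte_fin ax mul1r.
by rewrite !px; lra.
Qed.

Lemma stest_widen c d c' d' f : c' <= c -> d <= d' -> stest c d f -> stest c' d' f.
Proof.
move=> cc dd [sf f0]; split => // x /orP[xc|dx]; rewrite f0//.
  by rewrite (le_trans xc cc).
by rewrite (le_trans dd dx) orbT.
Qed.

(** Fix a test function r of nonzero mean. For any g, subtracting the multiple m of r that has the
    mean of g leaves psi of mean 0, the derivative of a test function. Then (f, psi) = 0 says that f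
    - l is orthogonal to g, where l = (f, r) / (1, r). *)
Lemma du_bois_reymond f : sq f ->
  (forall c d g, a < c -> c < d -> d < b -> stest c d g -> ip f (derive1 g) = 0) ->
  exists l, {ae mu, forall x, x \in `]a, b[ -> f x = l}.
Proof.
move=> sf f0; have [c0 [d0 [r [ac0 cd0 db0 rt r0]]]] := exists_stest_ip_neq0.
have s1 : sq (cst 1) by exact: sq_cst.
have sr := sq_smooth a b rt.1.
pose l := ip f r / ip (cst 1) r; exists l.
suff : {ae mu, forall x, x \in `]a, b[ -> (fun y => f y - l * cst 1 y) x = 0}.
  apply: filterS; first exact: (ae_filter_ringOfSetsType mu).
  by move=> x H /H /=; lra.
have sl : sq (fun y => l * cst 1 y) by exact: sqZ.
apply: (@ae_stest_eq0 _ a b (fun y => f y - l * cst 1 y)); first exact: sq_itg (sqB sf sl).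
move=> c d g ac cd db gt; have sg := sq_smooth a b gt.1.
rewrite ipBl// ipZl//.
pose m := ip (cst 1) g / ip (cst 1) r.
pose psi x := g x + (- m) * r x.
have psit : stest (Num.min c c0) (Num.max d d0) psi.
  have [gs gz] : stest (Num.min c c0) (Num.max d d0) g.
    by apply: stest_widen gt; rewrite ?ge_min ?le_max lexx.
  have [rs rz] : stest (Num.min c c0) (Num.max d d0) r.
    by apply: stest_widen rt; rewrite ?ge_min ?le_max lexx orbT.
  split; first exact: smoothD.
  by move=> x h; rewrite /psi gz// rz// mulr0 addr0.
have sNr : sq (fun x => (- m) * r x) by exact: sqZ.
have h1 : a < Num.min c c0 by rewrite lt_min ac.
have h2 : Num.min c c0 < Num.max d d0 by rewrite gt_min !lt_max cd.
have h3 : Num.max d d0 < b by rewrite gt_max db.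
have pb : prim psi b = 0.
  by rewrite prim_b ipC ipDr// ipZr// /m mulNr divfK// subrr.
have [pt dp] := stest_prim h1 h2 h3 psit pb.
have := f0 _ _ _ h1 h2 h3 pt; rewrite dp.
rewrite ipDr// ipZr// /m /l => H.
by rewrite -[RHS]H; field.
Qed.

Lemma test_derive1 f : test_function a b f -> test_function a b (derive1 f).
Proof.
move=> [sf cf fab].
have sub : closure [set x | derive1 f x != 0] `<=` closure [set x | f x != 0].
  rewrite [X in _ `<=` X](closure_id _).1; last exact: closed_closure.
  apply: closureS => x /= /eqP f'x; apply: contrapT => fx; apply: f'x.
  have : \forall y \near x, f y = 0.
    have : open (~` closure [set x | f x != 0]) by rewrite openC; exact: closed_closure.
    rewrite openE => /(_ x fx); rewrite /interior/=.
    apply: filterS => y yf; apply: contrapT => /eqP fy.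
    by apply: yf; exact: subset_closure.
  move=> nf; rewrite derive1E.
  have : is_derive x 1 f 0; last by move=> df; rewrite derive_val.
  apply: (@near_eq_is_derive _ _ _ (cst 0)).
  by apply: filterS nf => y ->.
split; first by move=> n x; rewrite -derive1Sn; exact: sf.
  by apply: subclosed_compact sub => //; exact: closed_closure.
exact: subset_trans fab.
Qed.

Lemma test_vanish f x : test_function a b f -> x \notin `]a, b[ -> f x = 0.
Proof.
move=> [_ _ fab] xab; apply/eqP; apply: contraNT xab => fx.
exact/fab/subset_closure.
Qed.

Lemma test_prim f : test_function a b f -> {in `[a, b], f =1 prim (derive1 f)}.
Proof.
move=> ft x xab; have fa : f a = 0 by rewrite (test_vanish ft)// in_itv/= ltxx.
have sf : smooth f by case: ft.
move: (xab); rewrite in_itv/= => /andP[]; rewrite le_eqVlt => /predU1P[<- _|ax xb].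
  by rewrite prim_a.
rewrite primE// /Rintegral (@continuous_FTC2 _ (derive1 f) f)//.
- by rewrite fa sube0.
- exact/continuous_subspaceT/smooth_continuous/smooth_derive1.
- split => [y _||]; first exact: (sf 0%N).
  + exact/cvg_at_right_filter/smooth_continuous.
  + exact/cvg_at_left_filter/smooth_continuous.
Qed.

Lemma sq_test f : test_function a b f -> sq f.
Proof. by move=> [sf _ _]; exact: sq_smooth. Qed.

(** So [f] is the weak derivative of [c + prim f]; the boundary terms vanish with [g]. *)
Lemma ip_test_derive1 c f g : sq f -> test_function a b g ->
  ip (fun x => c + prim f x) (derive1 g) = - ip f g.
Proof.
move=> sf gt; have sg' := sq_test (test_derive1 gt).
have pg : prim (derive1 g) b = 0.
  by rewrite -(test_prim gt) ?(test_vanish gt)// in_itv/= ?ltxx ?andbF// ltW//=.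
have [spf sc] : sq (prim f) /\ sq (fun x => c * cst 1 x).
  by split; [exact: (sq_prim ab (sq_itg sf))|exact: sqZ (sq_cst _ _ _)].
rewrite (@eq_ip _ _ _ _ (fun x => c * cst 1 x + prim f x) _ (derive1 g))//.
  rewrite ipDl// ipZl//; last exact: sq_cst.
  rewrite ipC -prim_b pg mulr0 add0r ipC (ip_prim ab)// pg mul0r sub0r.
  congr (- _); apply: eq_ip => // x xab.
  by rewrite (test_prim gt).
by move=> x _; rewrite mulr1.
Qed.

End WeakDerivatives.

(** * Translation of the Sobolev notions *)

Section SobolevBridge.
Context {R : realType}.
Variables a b : R.
Hypothesis ab : a < b.
Notation mu := (@lebesgue_measure R).
Notation ip := (ip a b).
Notation sq := (sq a b).
Notation itg := (itg a b).
Notation prim := (prim a b).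
Implicit Types (f g u v : R -> R) (c d x y : R) (k : nat).

Lemma Rintegral_oo f : itg f ->
  \int[mu]_(x in `]a, b[) f x = \int[mu]_(x in `[a, b]) f x.
Proof.
move=> fi; rewrite Rintegral_itv_bndo_bndc ?Rintegral_itv_obnd_cbnd//.
  by apply: integrableS fi => //; exact: subset_itv_oc_cc.
by apply: integrableS fi => //; exact: subset_itv_oo_cc.
Qed.

Lemma integral_patch_sqr f : sq f ->
  (\int[mu]_x (`| (EFin \o (f \_ `]a, b[)) x | `^ 2) = (ip f f)%:E)%E.
Proof.
move=> sf; have ffi := sq_mul sf sf.
rewrite /ip -Rintegral_oo// /Rintegral fineK.
  rewrite [RHS]integral_mkcond; apply: eq_integral => x _ /=.
  rewrite !patchE; case: ifP => _; last by rewrite normr0 powR0.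
  by rewrite powR_mulrn// -normrX ger0_norm ?sqr_ge0// expr2.
apply: integrable_fin_num => //.
by apply: integrableS ffi => //; exact: subset_itv_oo_cc.
Qed.

Lemma L2normE f : sq f -> L2norm a b f = (Num.sqrt (ip f f))%:E.
Proof.
move=> sf; rewrite /L2norm Lnorm.unlock integral_patch_sqr//=.
by rewrite powR12_sqrt// ip_ge0.
Qed.

Lemma L2E f : L2 a b f <-> sq f.
Proof.
split.
  move=> /[dup] /Lfun2_integrable_sqr fi; rewrite /L2 inE => /andP[/[!inE]/= mf _].
  split.
    apply/measurable_fun_itv_obnd_cbndP/measurable_fun_itv_bndo_bndcP.
    by apply/(measurable_restrictT _ _).2.
  move: fi; rewrite (_ : _ \o _ = (EFin \o (fun x => f x ^+ 2)) \_ `]a, b[).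
    move=> h; have {h}fi : mu.-integrable `]a, b[ (EFin \o (fun x => f x ^+ 2)).
      by apply/integrable_mkcond; [exact: measurable_itv|exact: h].
    have sqoo : measurable_fun `]a, b[ f by exact/(measurable_restrictT _ _).2.
    have moc : measurable_fun `[a, b] (fun x => f x ^+ 2).
      apply/measurable_fun_itv_obnd_cbndP/measurable_fun_itv_bndo_bndcP.
      exact: measurable_funX.
    apply/integrableP; split; first exact/measurable_EFinP.
    have /integrableP[_] := fi.
    rewrite integral_itv_bndo_bndc ?integral_itv_obnd_cbnd//.
      apply: measurableT_comp => //; apply/measurable_EFinP.
      by apply: measurable_funS moc => //; exact: subset_itv_oc_cc.
    apply: measurableT_comp => //; apply/measurable_EFinP.
    exact: measurable_funX.
  apply/funext => x /=; rewrite !patchE.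
  by case: ifP => //; rewrite expr0n.
move=> sf; rewrite /L2 inE; apply/andP; split; rewrite inE/=.
  apply/(measurable_restrictT _ _).1 => //.
  by apply: measurable_funS sf.1 => //; exact: subset_itv_oo_cc.
by rewrite /finite_norm -/(L2norm a b f) L2normE// ltry.
Qed.

Lemma weak_derivativeP k u v : sq u -> sq v ->
  is_weak_derivative a b k u v <->
  forall g, test_function a b g -> ip u (derive1n k g) = (-1) ^+ k * ip v g.
Proof.
move=> su sv.
have tn g : test_function a b g -> test_function a b (derive1n k g).
  by elim: k => // k ih gt; rewrite derive1nS; exact/test_derive1/ih.
split=> H g gt; have := H g gt; rewrite !Rintegral_oo//;
  by apply: sq_mul => //; apply: sq_test => //; exact: tn.
Qed.

(** The existence of [v] excludes the default value of [xget]. *)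
Lemma weak_derivative_spec k u v : sq v -> is_weak_derivative a b k u v ->
  sq (weak_derivative a b k u) /\
  is_weak_derivative a b k u (weak_derivative a b k u).
Proof.
move=> sv uv; rewrite /weak_derivative.
by case: xgetP => [w _ [/L2E]|/(_ v)[]//]; split => //; exact/L2E.
Qed.

Lemma weak_derivative_unique k u v w : sq u -> sq v -> sq w ->
  is_weak_derivative a b k u v -> is_weak_derivative a b k u w ->
  {ae mu, forall x, x \in `]a, b[ -> v x = w x}.
Proof.
move=> su sv sw /(weak_derivativeP k su sv) uv /(weak_derivativeP k su sw) uw.
suff : {ae mu, forall x, x \in `]a, b[ -> (fun y => v y - w y) x = 0}.
  apply: filterS; first exact: (ae_filter_ringOfSetsType mu).
  by move=> x H /H /eqP; rewrite subr_eq0 => /eqP.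
apply: (@ae_stest_eq0 _ a b (fun y => v y - w y)); first exact: sq_itg (sqB sv sw).
move=> c d g ac cd db gt; have tg := stest_test_function ac db gt.
rewrite ipBl//; last exact: sq_test.
apply/eqP; rewrite subr_eq0; apply/eqP.
apply: (mulfI (x := (-1) ^+ k)); first by rewrite signr_eq0.
by rewrite -uv// uw.
Qed.

(** Testing [w] against g' amounts, up to sign, to testing [u] against the derivative of g of order
    k + 1, hence to testing [v] against g. Thus [w - prim v] has weak derivative 0, and du
    Bois-Reymond applies. *)
Lemma weak_derivative_primitive k u v w : sq u -> sq v -> sq w ->
  is_weak_derivative a b k u w -> is_weak_derivative a b k.+1 u v ->
  exists l, {ae mu, forall x, x \in `]a, b[ -> w x = l + prim v x}.
Proof.
move=> su sv sw /(weak_derivativeP k su sw) uw /(weak_derivativeP k.+1 su sv) uv.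
have spv : sq (prim v) by exact: (sq_prim ab (sq_itg sv)).
have [|c d g ac cd db gt|l wl] := @du_bois_reymond _ a b ab (fun x => w x - prim v x).
- exact: sqB.
- have tg := stest_test_function ac db gt.
  rewrite ipBl//; last exact: sq_test (test_derive1 tg).
  have := ip_test_derive1 ab 0 sv tg.
  under [X in ip X _ = _ -> _]funext do rewrite add0r.
  move=> ->; rewrite opprK.
  apply: (mulfI (x := (-1) ^+ k)); first by rewrite signr_eq0.
  rewrite mulr0 mulrDr -uw; last exact: test_derive1.
  by rewrite -derive1Sn uv// exprS; ring.
exists l; apply: filterS wl; first exact: (ae_filter_ringOfSetsType mu).
by move=> x H /H <-; ring.
Qed.

End SobolevBridge.

(** * Iterated primitives and their weak and classical derivatives *)

Section DerivativeChain.
Context {R : realType}.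
Variables a b : R.
Hypothesis ab : a < b.
Notation ip := (ip a b).
Notation sq := (sq a b).
Notation prim := (prim a b).
Implicit Types (s g : R -> R) (l x y : R) (c : nat -> R) (i k : nat).

(* G i.+1 is the i.+1-st weak derivative of G 0, and the classical one if
   i.+1 < N. *)
Definition chain N (G : nat -> R -> R) (c : nat -> R) : Prop :=
  sq (G N) /\ forall i, (i < N)%N -> G i = (fun x => c i + prim (G i.+1) x).

Lemma chain_cons N G c s l : chain N G c -> s = (fun x => l + prim (G 0%N) x) ->
  chain N.+1 (fun i => if i is i'.+1 then G i' else s)
    (fun i => if i is i'.+1 then c i' else l).
Proof. by move=> [GN Gc] sE; split => // -[//|i /Gc]. Qed.

Lemma chain_sq N G c i : chain N G c -> (i <= N)%N -> sq (G i).
Proof.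
(* Induction downwards from [N], where square-integrability is given. *)
move=> [GN Gc] iN; rewrite -(subKn iN); elim: (N - i)%N (leq_subr i N) => [|k ih kN].
  by rewrite subn0.
have /ih {}ih : (k <= N)%N by exact: ltnW.
rewrite Gc; last by rewrite subnSK// leq_subr.
rewrite subnSK//; apply: sqD; first exact: sq_cst.
exact: (sq_prim ab (sq_itg ih)).
Qed.

Lemma chain_continuous N G c i : chain N G c -> (i < N)%N ->
  {within `[a, b], continuous (G i)}.
Proof.
move=> GN iN; rewrite (GN.2 _ iN) => x.
apply: continuousD; first exact: cst_continuous.
exact: (prim_continuous ab (sq_itg (chain_sq GN iN))).
Qed.

Lemma chain_ip_derive1n N G c k g : chain N G c -> (k <= N)%N ->
  test_function a b g -> ip (G 0%N) (derive1n k g) = (-1) ^+ k * ip (G k) g.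
Proof.
move=> GN; elim: k g => [g _ _|k ih g kN gt].
  by rewrite expr0 mul1r.
rewrite derive1Sn ih ?(ltnW kN)//; last exact: test_derive1.
rewrite (GN.2 _ kN) (ip_test_derive1 ab)//; last exact: chain_sq GN kN.
by rewrite exprS mulrN mulN1r mulNr.
Qed.

(** The bound on [k] is strict because differentiating [prim (G k.+1)] at every point uses
    continuity of [G k.+1], which is not guaranteed for [G N]. *)
Lemma chain_derive1n N G c k x : chain N G c -> (k < N)%N -> x \in `]a, b[ ->
  derive1n k (G 0%N) x = G k x.
Proof.
move=> GN; elim: k x => [//|k ih] x kN xab.
have kN' : (k < N)%N by exact: ltnW.
rewrite derive1nS derive1E.
have : is_derive x 1 (derive1n k (G 0%N)) (G k.+1 x).
  apply: (@near_eq_is_derive _ _ _ (G k)).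
    near=> y; apply/esym/ih => //; near: y.
    exact: near_in_itvoo.
  rewrite (GN.2 _ kN').
  have /andP[ax xb] : a < x < b by move: xab; rewrite in_itv.
  have dp : is_derive x 1 (prim (G k.+1)) (G k.+1 x).
    apply: is_derive_prim => //; first exact: sq_itg (chain_sq GN (ltnW kN)).
    have := chain_continuous GN kN; move/(continuous_within_itvP _ ab) => [H _ _].
    exact: H.
  have := is_deriveD (is_derive_cst (c k) x (1:R)) dp.
  by rewrite add0r.
by move=> dG; rewrite derive_val.
Unshelve. all: by end_near. Qed.

(** Integrates m more times, with constants 0; this undoes the reduction to q = 1. *)
Lemma chain_prim N G c m : chain N G c -> exists F d, chain (m + N) F d /\
  forall i, F (m + i)%N = G i.
Proof.
move=> GN; elim: m => [|m [F [d [Fd FG]]]]; first by exists G, c.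
eexists; eexists; split; first exact: (chain_cons (l := 0) Fd erefl).
by move=> i; rewrite addSn.
Qed.

Lemma chain_cvg_at_right N G c k : chain N G c -> (k < N)%N -> G k a = 0 ->
  derive1n k (G 0%N) x @[x --> a^'+] --> (0 : R).
Proof.
move=> GN kN Ga.
have /(continuous_within_itvP _ ab) [_ + _] := chain_continuous GN kN.
rewrite Ga; apply: cvg_trans; apply: near_eq_cvg; near=> x.
apply/esym/(chain_derive1n GN) => //; rewrite in_itv/=; apply/andP; split => //.
Unshelve. all: by end_near. Qed.

Lemma chain_cvg_at_left N G c k : chain N G c -> (k < N)%N -> G k b = 0 ->
  derive1n k (G 0%N) x @[x --> b^'-] --> (0 : R).
Proof.
move=> GN kN Gb.
have /(continuous_within_itvP _ ab) [_ _] := chain_continuous GN kN.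
rewrite Gb; apply: cvg_trans; apply: near_eq_cvg; near=> x.
apply/esym/(chain_derive1n GN) => //; rewrite in_itv/=; apply/andP; split => //.
Unshelve. all: by end_near. Qed.

End DerivativeChain.

(** * The constructed functions are symmetric splines *)

Section SplineStructure.
Context {R : realType}.
Variables (a b h : R) (n : nat).
Hypotheses (h0 : 0 < h) (n0 : (0 < n)%N) (hn : b = a + h * n%:R).
Notation mu := (@lebesgue_measure R).
Notation itg := (itg a b).
Notation prim := (prim a b).
Notation knot := (knot a h).
Notation chain := (chain a b).
Notation cell := (cell a h).
Implicit Types (f g s : R -> R) (l x y : R) (c : nat -> R) (j r i k : nat) (P Q : {poly R}).

Let ab : a < b.
Proof. by rewrite hn ltrDl mulr_gt0// ltr0n. Qed.

(** Unfolds the recursive construction into the list of derivatives of [s]. Each differentiation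
    flips the parity, so the boundary conditions fall on the indices of parity [e]. *)
Lemma spline_sp_chain e r s : spline_sp a b h n e r s -> exists G c,
  [/\ chain r G c, G 0%N = s, step_space a h n (G r) &
    forall i, (i < r)%N -> odd i = e -> G i a = 0 /\ G i b = 0].
Proof.
elim: r e s => [e s Vs|r ih e s] /=.
  exists (fun=> s), (fun=> 0); split => //; split => //.
  exact: fdim_sq (fdim_step_space _ _ _ _) Vs.
case: e => [[l [_ [[t Vt <-] sE]]]|[t [Vt /= tb] sE]].
- have [G [c [Gc G0 GV Gi]]] := ih _ _ Vt.
  exists (fun i => if i is i'.+1 then G i' else s).
  exists (fun i => if i is i'.+1 then c i' else l); split => //.
    by apply: chain_cons => //; rewrite G0 sE; apply/funext => x; rewrite mulr1.
  move=> [//|i] ir /= /negbTE io; apply: Gi => //.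
- have [G [c [Gc G0 GV Gi]]] := ih _ _ Vt.
  exists (fun i => if i is i'.+1 then G i' else s).
  exists (fun i => if i is i'.+1 then c i' else 0); split => //.
    by apply: chain_cons => //; rewrite G0 -sE; apply/funext => x; rewrite add0r.
  move=> [_ _|i ir /=]; first by rewrite -sE tb (prim_a ab).
  by move/negbFE => io; exact: Gi.
Qed.

Lemma poly_antiderivative P : exists2 Q, Q^`() = P & (size Q <= (size P).+1)%N.
Proof.
exists (\poly_(i < (size P).+1) (P`_i.-1 / i%:R)); last exact: size_poly.
apply/polyP => i; rewrite coef_deriv coef_poly ltnS.
have [iP|Pi] := ltnP i (size P); last by rewrite mul0rn nth_default.
by rewrite -[LHS]mulr_natr divfK// pnatr_eq0.
Qed.

Definition piecewise_poly m f : Prop := forall j, (j < n)%N ->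
  exists2 P : {poly R}, (size P <= m.+1)%N & forall x, cell j x -> f x = P.[x].

Lemma step_piecewise_poly f : step_space a h n f -> piecewise_poly 0 f.
Proof.
have mon m : (m <= n)%N -> step_space a h m f -> forall j, (j < n)%N ->
  exists2 P : {poly R}, (size P <= 1)%N & forall x, cell j x -> f x = P.[x].
  elim: m f => [|m ih] f mn.
    move=> [l [_ [-> ->]]] j _; exists l%:P; first exact: size_polyC_leq1.
    by move=> x _ /=; rewrite hornerC mulr1 addr0.
  move=> [l [g [Vg ->]]] j jn; have [P P1 gP] := ih _ (ltnW mn) Vg j jn.
  exists ((l * (j == m)%:R)%:P + P).
    by rewrite (leq_trans (size_polyD _ _))// geq_max size_polyC_leq1.
  move=> x xj; rewrite gP// hornerD hornerC indicE.
  suff -> : (x \in cell m) = (j == m) by [].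
  apply/idP/eqP => [/set_mem xm|<-]; last exact/mem_set.
  move: xj xm; rewrite /cell/= !in_itv/= => /andP[j1 j2] /andP[m1 m2].
  have := lt_le_trans j1 m2; have := lt_le_trans m1 j2.
  rewrite !ltrD2l !ltr_pM2l// !ltr_nat !ltnS => mj jm.
  by apply/eqP; rewrite eqn_leq jm.
exact: mon.
Qed.

Lemma prim_piecewise_poly m l f : itg f -> piecewise_poly m f ->
  piecewise_poly m.+1 (fun x => l + prim f x).
Proof.
move=> fi fP j jn; have [P Pm fPj] := fP j jn.
have [Q QP Qm] := poly_antiderivative P.
(* The constant matches the value of the primitive at the left knot, so pieces join continuously. *)
exists ((l + prim f (knot j) - Q.[knot j])%:P + Q).
  rewrite (leq_trans (size_polyD _ _))// geq_max (leq_trans (size_polyC_leq1 _))//=.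
  by rewrite (leq_trans Qm).
move=> x; rewrite /cell/= in_itv/= => /andP[jx xj].
have aj : a <= knot j by rewrite lerDl mulr_ge0// ltW.
have jb : knot j.+1 <= b by rewrite hn lerD2l ler_pM2l// ler_nat.
have := prim_sub fi aj (ltW jx) (le_trans xj jb).
have cQ : {within `[knot j, x], continuous (horner P)}.
  exact/continuous_subspaceT/continuous_horner.
have -> : \int[mu]_(t in `]knot j, x]) f t = Q.[x] - Q.[knot j].
  transitivity (\int[mu]_(t in `]knot j, x]) P.[t]).
    apply: eq_Rintegral => t; rewrite inE/= in_itv/= => /andP[jt tx].
    by apply: fPj; rewrite /cell/= in_itv/= jt (le_trans tx xj).
  have Pi : mu.-integrable `[knot j, x] (EFin \o horner P).
    by apply: continuous_compact_integrable => //; exact: segment_compact.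
  rewrite Rintegral_itv_obnd_cbnd; last first.
    by apply: integrableS Pi => //; exact: subset_itv_oc_cc.
  rewrite /Rintegral (@continuous_FTC2 _ (horner P) (horner Q))//.
  + split => [y _||]; first exact: derivable_horner.
    * exact/cvg_at_right_filter/continuous_horner.
    * exact/cvg_at_left_filter/continuous_horner.
  + by move=> y _; rewrite -derivE QP.
by rewrite hornerD hornerC; lra.
Qed.

Lemma chain_piecewise_poly N G c i : chain N G c -> step_space a h n (G N) ->
  (i <= N)%N -> piecewise_poly i (G (N - i)%N).
Proof.
move=> GN GV; elim: i => [_|i ih iN].
  by rewrite subn0; exact: step_piecewise_poly.
rewrite (GN.2 (N - i.+1)%N); last by rewrite subnSK// leq_subr.
rewrite subnSK//; apply: prim_piecewise_poly; last exact/ih/ltnW.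
by apply: sq_itg; apply: (chain_sq ab GN); exact: leq_subr.
Qed.

Lemma chain_spline N G c : chain N G c -> step_space a h n (G N) ->
  grid_count a b h = n -> spline_space a b N h (G 0%N).
Proof.
move=> GN GV gn; split.
  split; first exact/L2E/(chain_sq ab GN).
  move=> k kN; exists (G k); split; first exact/L2E/(chain_sq ab GN).
  apply/weak_derivativeP => //; [exact: (chain_sq ab GN)|exact: (chain_sq ab GN)|].
  by move=> g; exact: (chain_ip_derive1n ab GN).
rewrite gn; have := chain_piecewise_poly GN GV (leqnn N).
by rewrite subnn.
Qed.

End SplineStructure.

(** * Reduction to q = 1 and conclusion *)

Theorem theorem5 (R : realType) (a b : R) (hab : a < b)
    (h : R) (hh : is_grid_size a b h)
    (p q : nat) (hp : (0 < p)%N) (hq : (0 < q)%N) (hqp : (q <= p + 1)%N)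
    (hgrid : h * (p%:R - q%:R + 1) < b - a)
    (u : R -> R) (hu : sobolev a b q u) :
  exists2 uph : R -> R, symmetric_spline_space a b q p h uph &
    (sobolev_seminorm a b q.-1 (u \- uph)%R
     <= (Num.sqrt 2 * h)%:E * sobolev_seminorm a b q u)%E.
Proof.
have [h0 [n n0 nE]] := hh.
have hn : b = a + h * n%:R by rewrite -nE mulrA divff ?gt_eqF// mul1r; ring.
have gn : grid_count a b h = n.
  by rewrite /grid_count nE; apply: truncn_def; rewrite lexx ltr_nat /=.
have su : sq a b u by apply/L2E; case: hu.
have weak k : (k <= q)%N -> exists2 w, sq a b w & is_weak_derivative a b k u w.
  by move=> kq; have [w [/L2E sw uw]] := hu.2 k kq; exists w.
have [w sw uw] := weak q.-1 (leq_pred q).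
have [v' sv' uv'] := weak q (leqnn q).
have [sv uv] := weak_derivative_spec sv' uv'.
rewrite /sobolev_seminorm; set v := weak_derivative a b q u in sv uv *.
have [l wl] : exists l, {ae lebesgue_measure, forall x,
    x \in `]a, b[ -> w x = l + prim a b v x}.
  apply: (weak_derivative_primitive hab su sv sw uw); rewrite prednK//.
(* Since q <= p + 1, the natural subtraction is exact. *)
pose r := (p.+1 - q)%N; have pE : p = (q.-1 + r)%N by rewrite /r; lia.
have [s0 Vs0 s0v] := spline_approximation h0 n0 hn r sv (or_introl (erefl true)).
(* Almost everywhere [w = l + prim v], so [w] is approximated by [l + s0], with the error of [s0]
   for [prim v]. *)
have Vs := fdim_lin l (fdim_spline_sp h0 n0 hn true r)
  (spline_sp_cst1 h0 n0 hn r) Vs0.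
have [G [c [Gc G0 GV Gi]]] := spline_sp_chain h0 n0 hn Vs.
have [F [d [Fd FG]]] := chain_prim q.-1 Gc.
rewrite -pE in Fd.
have FV : step_space a h n (F p) by rewrite pE FG.
have sF i : (i <= p)%N -> sq a b (F i) by exact: (chain_sq hab Fd).
exists (F 0%N).
  split; first exact: (chain_spline h0 n0 hn Fd FV gn).
  (* The derivative of order 2k + q of [F 0] is [G (2 * k).+1]: the first q - 1 differentiations
     undo the added primitives, and an odd index remains. *)
  move=> k kp; have kE : (2 * k + q = q.-1 + (2 * k).+1)%N by lia.
  have [Ga Gb] : G (2 * k).+1 a = 0 /\ G (2 * k).+1 b = 0.
    by apply: Gi; [rewrite /r; lia|rewrite /= oddM].
  split; first by apply: (chain_cvg_at_right hab Fd) => //; rewrite kE FG.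
  by apply: (chain_cvg_at_left hab Fd) => //; rewrite kE FG.
have qp : (q.-1 <= p)%N by lia.
have [sF0 sFq] := (sF 0%N (leq0n _), sF _ qp).
have suF : sq a b (u \- F 0%N) by exact: sqB.
(* The seminorm uses a chosen representative [o], which is identified with this explicit derivative
   almost everywhere. *)
have wF : is_weak_derivative a b q.-1 (u \- F 0%N) (fun x => w x - F q.-1 x).
  apply/weak_derivativeP => //; first exact: sqB.
  move=> g tg; have tgk : sq a b (derive1n q.-1 g).
    by apply: sq_smooth => m x; rewrite /derive1n -iterD; case: tg => + _ _; exact.
  have sg := sq_test tg.
  rewrite (ipBl sw sFq)// [LHS](ipBl su sF0)// (chain_ip_derive1n hab Fd qp tg).
  by rewrite ((weak_derivativeP _ su sw).1 uw)// mulrBr.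
have swF : sq a b (fun x => w x - F q.-1 x) by exact: sqB.
have [so uo] := weak_derivative_spec swF wF.
set o := weak_derivative a b q.-1 _ in so uo *.
have ow := weak_derivative_unique suF so swF uo wF.
have ss0 := fdim_sq (fdim_spline_sp h0 n0 hn true r) Vs0.
have spv := sq_prim hab (sq_itg sv).
have ov : ip a b o o <= h ^+ 2 * ip a b v v.
  rewrite (_ : ip a b o o = ip a b (fun x => prim a b v x - s0 x)
    (fun x => prim a b v x - s0 x))//.
  apply: ae_ip => //; first exact: sqB.
  apply: filterS2 ow wl; first exact: (ae_filter_ringOfSetsType lebesgue_measure).
  move=> x ox wx xab; rewrite ox// wx// (_ : F q.-1 x = l * cst 1 x + s0 x) /=.
    by ring.
  by rewrite -[q.-1]addn0 FG G0.
rewrite /sobolev_seminorm !L2normE// lee_fin.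
have h2 : Num.sqrt (h ^+ 2) = h by rewrite sqrtr_sqr gtr0_norm.
(* The estimate obtained has constant 1, and 1 <= sqrt 2. *)
apply: (@le_trans _ _ (h * Num.sqrt (ip a b v v))).
  by rewrite -h2 -sqrtrM ?sqr_ge0// ler_sqrt// mulr_ge0 ?sqr_ge0// ip_ge0.
rewrite ler_wpM2r ?sqrtr_ge0// ler_peMl ?(ltW h0)//.
by rewrite -[leLHS]sqrtr1 ler_sqrt// ler1n.
Qed.
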